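(* Let $\mathcal{X}$ and $\mathcal{Z}$ be Euclidean spaces. Let $\mathfrak{S}:\mathcal{X}\to\mathcal{Z}$ be a differentiable mapping such that $\mathfrak{S}$ and its G\^ateaux derivative $\mathrm{D}\mathfrak{S}$ are Lipschitz continuous; let $g:\mathcal{Z}\to\mathbb{R}$ be Lipschitz continuous and $\eta$-weakly convex for some $\eta>0$; let $C\subset\mathcal{X}$ be a nonempty closed prox-regular set; set $F:=g\circ\mathfrak{S}$ and assume $\mathop{\mathrm{argmin}}_{x\in C}F(x)\neq\emptyset$. Choose $x_1\in C$, $c\in(0,1/2)$, $\rho\in(0,1)$, $\tilde\gamma>0$ and $\alpha\ge1$, and let $(x_n)_{n\ge1}\subset C$ and $(\gamma_n)_{n\ge1}$ be generated by the following projected variable smoothing algorithm: for $n=1,2,\dots$, set $\mu_n:=(2\eta)^{-1}n^{-1/\alpha}$ and $F_n:={}^{\mu_n}g\circ\mathfrak{S}$; then for $m=0,1,2,\dots$, pick some $x\in P_C\big(x_n-\rho^m\tilde\gamma\nabla F_n(x_n)\big)$, and if $F_n(x)\le F_n(x_n)-c\rho^m\tilde\gamma\big\|\frac{x_n-x}{\rho^m\tilde\gamma}\big\|^2$ holds, set $x_{n+1}:=x$, $\gamma_n:=\rho^m\tilde\gamma$ and stop the inner loop. Then: (a) $\liminf_{n\to\infty}\mathcal{M}_{\gamma_n}^{F_n,\iota_C}(x_n)=0$; (b) for any subsequence $(x_{m(l)})_{l\ge1}$ of $(x_n)$, with $m:\mathbb{N}\to\mathbb{N}$ monotonically increasing,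 such that $\lim_{l\to\infty}\mathcal{M}_{\gamma_{m(l)}}^{F_{m(l)},\iota_C}(x_{m(l)})=0$, every cluster point $x^\star\in C$ of $(x_{m(l)})_{l\ge1}$ satisfies $0\in\partial_F(F+\iota_C)(x^\star)$, i.e. is a stationary point of minimizing $F$ over $C$.
   Context: Prox-regularity of $C$: the metric projection $P_C(\bar x):=\mathop{\mathrm{argmin}}_{x\in C}\|\bar x-x\|$ (nonempty for every $\bar x$ since $C$ is closed) is single-valued on some open subset of $\mathcal{X}$ containing $C$. $\iota_C$ is the indicator function of $C$ ($0$ on $C$, $+\infty$ elsewhere). For a proper $J:\mathcal{X}\to\mathbb{R}\cup\{+\infty\}$, the Fr\'echet subdifferential $\partial_F J(\bar x)$ at $\bar x\in\mathrm{dom}\,J$ is the set of $v$ with $\sup_{\epsilon>0}\inf_{0<\|x-\bar x\|<\epsilon}\frac{J(x)-J(\bar x)-\langle v,x-\bar x\rangle}{\|x-\bar x\|}\ge0$ (empty if $\bar x\notin\mathrm{dom}\,J$); for continuously differentiable $J$ it equals $\{\nabla J(\bar x)\}$. For $\mu\in(0,\eta^{-1})$, $\mathrm{prox}_{\mu g}(\bar z):=\mathop{\mathrm{argmin}}_{z\in\mathcal{Z}}\big(g(z)+\frac{1}{2\mu}\|z-\bar z\|^2\big)$ is single-valued and the Moreau envelope ${}^{\mu}g(\bar z):=g(\mathrm{prox}_{\mu g}(\bar z))+\frac{1}{2\mu}\|\mathrm{prox}_{\mu g}(\bar z)-\bar z\|^2$ is continuously differentiable with $\nabla{}^{\mu}g(\bar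 z)=\mu^{-1}(\bar z-\mathrm{prox}_{\mu g}(\bar z))$. For a function $J:\mathcal{X}\to\mathbb{R}$, $\gamma>0$ and $\bar x\in\mathcal{X}$, $\mathcal{M}_{\gamma}^{J,\iota_C}(\bar x):=\mathrm{dist}\big(0,\{(\bar x-p)/\gamma : p\in P_C(\bar x-\gamma v),\ v\in\partial_F J(\bar x)\}\big)$, with $\mathrm{dist}(0,S)=\inf_{s\in S}\|s\|$. *)

(* Defs.v *)
(* Euclidean spaces are modelled as 'rV[R]_n with the
   standard inner product (every Euclidean space is isometric to some R^n). *)
From HB Require Import structures.
From mathcomp Require Import all_boot all_order all_algebra.
From mathcomp Require Import all_classical all_reals all_analysis.
Set Implicit Arguments. Unset Strict Implicit. Unset Printing Implicit Defensive.
Import Order.TTheory GRing.Theory Num.Theory.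
Import numFieldNormedType.Exports.
Local Open Scope classical_set_scope.
Local Open Scope ring_scope.

Section Defs.
Variable R : realType.

Definition dotv n (u v : 'rV[R]_n) : R := \sum_(i < n) u ord0 i * v ord0 i.
Definition enorm n (u : 'rV[R]_n) : R := Num.sqrt (dotv u u).

Definition elipschitz n k (f : 'rV[R]_n -> 'rV[R]_k) :=
  exists L : R, forall x y, enorm (f x - f y) <= L * enorm (x - y).
Definition elipschitz_real n (f : 'rV[R]_n -> R) :=
  exists L : R, forall x y, `|f x - f y| <= L * enorm (x - y).

(* the (Gateaux = Frechet) derivative DS x : v |-> 'd S x v is Lipschitz in x,
   w.r.t. the operator norm (written out) *)
Definition deriv_lipschitz n k (S : 'rV[R]_n -> 'rV[R]_k) :=
  exists L : R, forall x y v,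
    enorm ('d S x v - 'd S y v) <= L * enorm (x - y) * enorm v.

Definition convex_fun n (h : 'rV[R]_n -> R) :=
  forall x y (t : R), 0 <= t <= 1 ->
    h (t *: x + (1 - t) *: y) <= t * h x + (1 - t) * h y.

Definition weakly_convex n (eta : R) (g : 'rV[R]_n -> R) :=
  convex_fun (fun z => g z + eta / 2 * enorm z ^+ 2).

Definition in_proj n (C : set 'rV[R]_n) (xb p : 'rV[R]_n) :=
  C p /\ forall x, C x -> enorm (xb - p) <= enorm (xb - x).

Definition prox_regular n (C : set 'rV[R]_n) :=
  exists U : set 'rV[R]_n, open U /\ C `<=` U /\
    forall xb p q, U xb -> in_proj C xb p -> in_proj C xb q -> p = q.

Definition moreau n (mu : R) (g : 'rV[R]_n -> R) (zb : 'rV[R]_n) : R :=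
  inf [set g z + (2 * mu)^-1 * enorm (z - zb) ^+ 2 | z in [set: 'rV[R]_n]].

Definition grad n (f : 'rV[R]_n -> R) (x : 'rV[R]_n) : 'rV[R]_n :=
  \row_(i < n) ('d f x (delta_mx ord0 i : 'rV[R]_n) : R).

Definition iotaC n (C : set 'rV[R]_n) (x : 'rV[R]_n) : \bar R :=
  if `[< C x >] then 0%E else +oo%E.

(* Frechet subdifferential: v \in d_F J(xb), with the liminf condition
   sup_{e>0} inf_{0<||x-xb||<e} (J x - J xb - <v,x-xb>)/||x-xb|| >= 0 written out *)
Definition frechet_subdiff n (J : 'rV[R]_n -> \bar R) (xb v : 'rV[R]_n) :=
  J xb \is a fin_num /\
  forall d : R, 0 < d -> exists e : R, 0 < e /\
    forall x, 0 < enorm (x - xb) < e ->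
      ((- d * enorm (x - xb))%:E <= J x - J xb - (dotv v (x - xb))%:E)%E.

Definition Mstat n (gamma : R) (J : 'rV[R]_n -> \bar R) (C : set 'rV[R]_n)
    (xb : 'rV[R]_n) : \bar R :=
  ereal_inf [set (enorm (gamma^-1 *: (xb - p)))%:E |
     p in [set p | exists v, frechet_subdiff J xb v /\
                             in_proj C (xb - gamma *: v) p]].

End Defs.

(* Main.v *)
(* The smoothed objective [moreau mu g \o S] lies above its linearizations up to
   a quadratic error bounded independently of [mu], and below them up to a
   quadratic error of order [1 / mu].  By the upper bound, backtracking stops at
   a step [gam j] of order at least [mu j]; since the energy
   [moreau (mu j) g (S (x j)) + L ^+ 2 / 2 * mu j] decreases by [c * gam j]
   times the squared stationarity measure and the sum of the [mu j] diverges
   like the harmonic series, the measure cannot stay away from [0].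

   For cluster points, single-valuedness of the projection on an open set is
   first turned into a locally uniform inequality
   [<w, y - a> <= |w| / (2 r) |y - a|^2] for the proximal normals [w] at [a]: a
   point projecting to [a] can be pushed away from [a] along the normal,
   doubling its distance, until it is at distance [r].  Added to the lower
   bound at an iterate close to [xs], where minus the gradient is almost a
   proximal normal, it gives [g (S xs) - K |y - xs|^2 <= g (S y)] on [C]. *)
Require Import Defs.
From HB Require Import structures.
From mathcomp Require Import all_boot all_order all_algebra.
From mathcomp Require Import all_classical all_reals all_analysis.
From mathcomp Require Import ring lra.
Set Implicit Arguments.
Unset Strict Implicit.
Unset Printing Implicit Defensive.
Import Order.TTheory GRing.Theory Num.Theory.
Import numFieldNormedType.Exports.
Local Open Scope classical_set_scope.
Local Open Scope ring_scope.

Lemma ler_addM_small (R : realFieldType) (a b c t0 : R) : 0 < t0 ->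
  (forall t, 0 < t <= t0 -> a <= b + t * c) -> a <= b.
Proof.
move=> t00 le_ab; apply/ler_addgt0Pr => e e0.
have c0 : 0 < `|c| + 1 by rewrite ltr_wpDl.
pose t := Num.min t0 (e / (`|c| + 1)).
have t_gt0 : 0 < t by rewrite lt_min t00 divr_gt0.
apply: le_trans (le_ab t _) _; first by rewrite t_gt0 ge_min lexx.
rewrite lerD2l (@le_trans _ _ (t * (`|c| + 1))) //.
  by rewrite ler_pM2l // ler_wpDr // ler_norm.
by rewrite -ler_pdivlMr // ge_min lexx orbT.
Qed.

Lemma ler_norm1M (R : realDomainType) (L a b : R) :
  0 <= b -> a <= L * b -> a <= (`|L| + 1) * b.
Proof.
move=> b0 /le_trans; apply.
by rewrite ler_wpM2r // ler_wpDr // ler_norm.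
Qed.

Section EuclideanSpace.
Variables (R : realType) (n : nat).
Implicit Types (u v w x y : 'rV[R]_n) (a t : R).

Lemma dotvC u v : dotv u v = dotv v u.
Proof. by apply: eq_bigr => i _; rewrite mulrC. Qed.

Lemma dotvDl u v w : dotv (u + v) w = dotv u w + dotv v w.
Proof. by rewrite -big_split; apply: eq_bigr => i _; rewrite mxE mulrDl. Qed.

Lemma dotvZl a u v : dotv (a *: u) v = a * dotv u v.
Proof. by rewrite mulr_sumr; apply: eq_bigr => i _; rewrite mxE mulrA. Qed.

Lemma dotvNl u v : dotv (- u) v = - dotv u v.
Proof. by rewrite -scaleN1r dotvZl mulN1r. Qed.

Lemma dotvDr u v w : dotv w (u + v) = dotv w u + dotv w v.
Proof. by rewrite !(dotvC w) dotvDl. Qed.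

Lemma dotvZr a u v : dotv u (a *: v) = a * dotv u v.
Proof. by rewrite !(dotvC u) dotvZl. Qed.

Lemma dotvNr u v : dotv u (- v) = - dotv u v.
Proof. by rewrite !(dotvC u) dotvNl. Qed.

Definition dotvE := (dotvDl, dotvDr, dotvNl, dotvNr, dotvZl, dotvZr).

Lemma dotv0l u : dotv 0 u = 0.
Proof. by rewrite -(scale0r 0) dotvZl mul0r. Qed.

Lemma dotvv_ge0 u : 0 <= dotv u u.
Proof. by apply: sumr_ge0 => i _; rewrite -expr2 sqr_ge0. Qed.

Lemma enorm_ge0 u : 0 <= enorm u.
Proof. exact: sqrtr_ge0. Qed.

Lemma enorm_sqr u : enorm u ^+ 2 = dotv u u.
Proof. by rewrite sqr_sqrtr // dotvv_ge0. Qed.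

Lemma enorm0 : enorm (0 : 'rV[R]_n) = 0.
Proof. by rewrite /enorm dotv0l sqrtr0. Qed.

Lemma enorm_eq0 u : (enorm u == 0) = (u == 0).
Proof.
apply/eqP/eqP => [u0|->]; last exact: enorm0.
have /eqP : dotv u u = 0 by rewrite -enorm_sqr u0 expr0n.
rewrite psumr_eq0 => [/allP uu0|i _]; last by rewrite -expr2 sqr_ge0.
apply/rowP => i; rewrite mxE; apply/eqP.
by have := uu0 i (mem_index_enum i); rewrite /= mulf_eq0 orbb.
Qed.

Lemma enorm_gt0 u : (0 < enorm u) = (u != 0).
Proof. by rewrite lt_def enorm_ge0 andbT enorm_eq0. Qed.

Lemma enormZ a u : enorm (a *: u) = `|a| * enorm u.
Proof.
by rewrite /enorm dotvZl dotvZr mulrA -expr2 sqrtrM ?sqr_ge0 // sqrtr_sqr.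
Qed.

Lemma enormZ_ge0 a u : 0 <= a -> enorm (a *: u) = a * enorm u.
Proof. by move=> a0; rewrite enormZ ger0_norm. Qed.

Lemma enormN u : enorm (- u) = enorm u.
Proof. by rewrite -scaleN1r enormZ normrN normr1 mul1r. Qed.

Lemma enormBC u v : enorm (u - v) = enorm (v - u).
Proof. by rewrite -enormN opprB. Qed.

Lemma enorm_sqrD u v :
  enorm (u + v) ^+ 2 = enorm u ^+ 2 + 2 * dotv u v + enorm v ^+ 2.
Proof. by rewrite !enorm_sqr !dotvE (dotvC v u); ring. Qed.

Lemma enorm_sqrB u v :
  enorm (u - v) ^+ 2 = enorm u ^+ 2 - 2 * dotv u v + enorm v ^+ 2.
Proof. by rewrite enorm_sqrD dotvNr enormN; ring. Qed.

Lemma enorm_sqrD_le u v :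
  enorm (u + v) ^+ 2 <= 2 * (enorm u ^+ 2 + enorm v ^+ 2).
Proof.
by have := sqr_ge0 (enorm (u - v)); rewrite enorm_sqrB enorm_sqrD; lra.
Qed.

Lemma enorm_sqr_conv t u v : enorm (t *: u + (1 - t) *: v) ^+ 2 =
  t * enorm u ^+ 2 + (1 - t) * enorm v ^+ 2 - t * (1 - t) * enorm (u - v) ^+ 2.
Proof. by rewrite !enorm_sqr !dotvE (dotvC v u); ring. Qed.

Lemma dotv_le u v : dotv u v <= enorm u * enorm v.
Proof.
have [->|v0] := eqVneq v 0; first by rewrite dotvC dotv0l enorm0 mulr0.
have [->|u0] := eqVneq u 0; first by rewrite dotv0l enorm0 mul0r.
have := sqr_ge0 (enorm (enorm v *: u - enorm u *: v)).
rewrite enorm_sqrB !enormZ_ge0 ?enorm_ge0 // dotvZl dotvZr.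
have := mulr_gt0 (etrans (enorm_gt0 u) u0) (etrans (enorm_gt0 v) v0).
move: (enorm u) (enorm v) (dotv u v) => a b d ab0 sq_ge0.
rewrite -subr_ge0 -(pmulr_rge0 _ ab0) -(@pmulr_rge0 _ 2) //.
by apply: le_trans sq_ge0 _; rewrite le_eqVlt; apply/orP; left; apply/eqP; ring.
Qed.

Lemma dotv_norm_le u v : `|dotv u v| <= enorm u * enorm v.
Proof. by rewrite ler_norml dotv_le lerNl -dotvNl -(enormN u) dotv_le. Qed.

Lemma enorm_le_dual u a : 0 <= a ->
  (forall v, dotv u v <= a * enorm v) -> enorm u <= a.
Proof.
move=> a0 /(_ u); rewrite -enorm_sqr expr2.
have [->|u0] := eqVneq u 0; first by rewrite enorm0.
by rewrite ler_pM2r // enorm_gt0.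
Qed.

Lemma enormD u v : enorm (u + v) <= enorm u + enorm v.
Proof.
rewrite -(@ler_pXn2r _ 2) ?nnegrE ?addr_ge0 ?enorm_ge0 // enorm_sqrD.
have := dotv_le u v; lra.
Qed.

Lemma enormB_triangle v u w : enorm (u - w) <= enorm (u - v) + enorm (v - w).
Proof. by apply: le_trans (enormD _ _); rewrite addrA subrK. Qed.

Lemma enormB_norm u v : `|enorm u - enorm v| <= enorm (u - v).
Proof.
have := enormB_triangle v u 0; have := enormB_triangle u v 0.
rewrite !subr0 (enormBC v u) ler_norml; lra.
Qed.

Lemma dotv_max_colinear u v a : v != 0 -> enorm u <= a ->
  a * enorm v <= dotv u v -> u = (a / enorm v) *: v.
Proof.
rewrite -enorm_gt0 => v0 ua uv; apply/eqP; rewrite -subr_eq0 -enorm_eq0.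
have a0 : 0 <= a by exact: le_trans (enorm_ge0 u) ua.
rewrite -sqrf_eq0 eq_le sqr_ge0 andbT enorm_sqrB.
rewrite enormZ_ge0 ?divr_ge0 ?(ltW v0) // divfK ?gt_eqF // dotvZr.
have : a * a <= a / enorm v * dotv u v.
  by rewrite -mulrA ler_wpM2l // ler_pdivlMl // mulrC.
have : enorm u ^+ 2 <= a ^+ 2 by rewrite ler_pXn2r ?nnegrE ?enorm_ge0.
rewrite !expr2; lra.
Qed.

Lemma normr_le_enorm x : `|x| <= enorm x.
Proof.
rewrite /Num.norm /= mx_normrE; apply/bigmax_leP; split; first exact: enorm_ge0.
move=> [i j] _ /=; rewrite (ord1 i) -(@ler_pXn2r _ 2) ?nnegrE ?enorm_ge0 //.
rewrite enorm_sqr real_normK ?num_real // /dotv (bigD1 j) //= -expr2.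
by rewrite lerDl sumr_ge0 // => l _; rewrite -expr2 sqr_ge0.
Qed.

Lemma coord_le_normr x i : `|x ord0 i| <= `|x|.
Proof.
rewrite [leRHS]/Num.norm /= mx_normrE.
exact: (le_bigmax _ (fun ij => `|x ij.1 ij.2|) (ord0, i)).
Qed.

Lemma enorm_le_normr x : enorm x <= n%:R * `|x|.
Proof.
rewrite -(@ler_pXn2r _ 2) ?nnegrE ?mulr_ge0 ?enorm_ge0 // enorm_sqr.
apply: (@le_trans _ _ (\sum_(i < n) `|x| ^+ 2)).
  apply: ler_sum => i _; rewrite -expr2 -real_normK ?num_real //.
  by rewrite ler_pXn2r ?nnegrE // coord_le_normr.
rewrite sumr_const card_ord -[leLHS]mulr_natl exprMn ler_wpM2r ?sqr_ge0 //.
by rewrite -natrX ler_nat; case: (n) => // m; rewrite expnS expn1 leq_pmulr.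
Qed.

Lemma nbhs_enormP x (A : set 'rV[R]_n) :
  nbhs x A <-> exists2 e, 0 < e & forall y, enorm (y - x) < e -> A y.
Proof.
split=> [/nbhs_ballP [e /= e0 eA]|[e e0 eA]].
  exists e => // y yx; apply: eA; rewrite -ball_normE /= distrC.
  exact: le_lt_trans (normr_le_enorm _) yx.
apply/nbhs_ballP; exists (e / n.+1%:R) => /=; first by rewrite divr_gt0.
move=> y; rewrite -ball_normE /= distrC => yx; apply: eA.
apply: le_lt_trans (enorm_le_normr _) _.
apply: (@le_lt_trans _ _ (n.+1%:R * `|y - x|)).
  by rewrite ler_wpM2r ?ler_nat.
by rewrite mulrC -ltr_pdivlMr ?ltr0n.
Qed.

Lemma elipschitz_pos k (f : 'rV[R]_n -> 'rV[R]_k) : elipschitz f ->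
  exists2 L, 0 < L & forall x y, enorm (f x - f y) <= L * enorm (x - y).
Proof.
move=> [L fL]; exists (`|L| + 1) => [|x y]; first by rewrite ltr_wpDl.
by apply: ler_norm1M => //; exact: enorm_ge0.
Qed.

Lemma elipschitz_real_pos (f : 'rV[R]_n -> R) : elipschitz_real f ->
  exists2 L, 0 < L & forall x y, `|f x - f y| <= L * enorm (x - y).
Proof.
move=> [L fL]; exists (`|L| + 1) => [|x y]; first by rewrite ltr_wpDl.
by apply: ler_norm1M => //; exact: enorm_ge0.
Qed.

Lemma deriv_lipschitz_pos k (f : 'rV[R]_n -> 'rV[R]_k) : deriv_lipschitz f ->
  exists2 L, 0 < L &
    forall x y v, enorm ('d f x v - 'd f y v) <= L * enorm (x - y) * enorm v.
Proof.
move=> [L fL]; exists (`|L| + 1) => [|x y v]; first by rewrite ltr_wpDl.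
by rewrite -mulrA; apply: ler_norm1M; rewrite ?mulrA // mulr_ge0 ?enorm_ge0.
Qed.

Lemma elipschitz_real_continuous (f : 'rV[R]_n -> R) :
  elipschitz_real f -> continuous f.
Proof.
move=> /elipschitz_real_pos[L L0 fL] x.
apply/(@cvgrPdist_le _ _ _ (nbhs x)) => e e0.
apply/nbhs_enormP; exists (e / L) => [|y yx]; first exact: divr_gt0.
rewrite distrC; apply: le_trans (fL y x) _.
by rewrite -ler_pdivlMl // mulrC ltW.
Qed.

Lemma enorm_sub_continuous x : continuous (fun y => enorm (y - x)).
Proof.
apply: elipschitz_real_continuous; exists 1 => y z; rewrite mul1r.
by apply: le_trans (enormB_norm _ _) _; rewrite opprB addrA subrK.
Qed.

Definition eball x (r : R) : set 'rV[R]_n := [set y | enorm (y - x) <= r].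

Lemma closed_eball x r : closed (eball x r).
Proof.
have /continuous_closedP/(_ _ (@closed_le R r)) := @enorm_sub_continuous x.
exact.
Qed.

Lemma eballxx x r : 0 <= r -> eball x r x.
Proof. by rewrite /eball /= subrr enorm0. Qed.

Lemma compact_eballI x r (A : set 'rV[R]_n) :
  closed A -> compact (A `&` eball x r).
Proof.
move=> cA; apply: bounded_closed_compact; last first.
  exact: closedI cA (@closed_eball x r).
exists (r + enorm x); split=> [|M rM y [_ yr]]; first exact: num_real.
apply: le_trans (normr_le_enorm y) _; apply: le_trans (ltW rM).
by rewrite -[y in leLHS](subrK x) (le_trans (enormD _ _)) // lerD2r.
Qed.

Lemma cluster_enorm (u : nat -> 'rV[R]_n) x : cluster (u @ \oo) x ->
  forall e N, 0 < e -> exists2 i, (N <= i)%N & enorm (u i - x) < e.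
Proof.
move=> ux e N e0.
have [||y [[i Ni ->] /= ?]] := ux [set y | exists2 i, (N <= i)%N & y = u i]
  [set y | enorm (y - x) < e].
- by exists N => // i /= Ni; exists i.
- by apply/nbhs_enormP; exists e.
- by exists i.
Qed.

End EuclideanSpace.

Lemma in_proj_exists (R : realType) n (C : set 'rV[R]_n) z :
  C !=set0 -> closed C -> exists p, in_proj C z p.
Proof.
move=> [a Ca] cC; pose K := C `&` eball z (enorm (a - z)).
have [|||p] := @EVT_min_rV R n (fun y => enorm (y - z)) K.
- by exists a; split=> //=; rewrite /eball /=.
- exact: compact_eballI.
- exact/continuous_subspaceT/enorm_sub_continuous.
rewrite inE => -[Cp pz] pmin; exists p; split=> // y Cy.
rewrite !(enormBC z); have [yz|/ltW] := leP (enorm (y - z)) (enorm (a - z)).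
  by apply: pmin; rewrite inE.
exact: le_trans.
Qed.

Section Projection.
Variables (R : realType) (n : nat) (C : set 'rV[R]_n).
Implicit Types (x y z p q a h v w : 'rV[R]_n) (r s t e : R).

Lemma in_proj_ray a v s t : 0 <= t <= s ->
  in_proj C (a + s *: v) a -> in_proj C (a + t *: v) a.
Proof.
move=> /andP[t0 ts] [Ca amin]; split=> // y Cy.
have := le_trans (amin y Cy) (enormB_triangle (a + t *: v) _ _).
rewrite (addrC a (s *: v)) addrK [a + t *: v - a]addrC addKr.
rewrite (addrC a) opprD addrACA subrr addr0 -scalerBl.
rewrite !enormZ_ge0 ?subr_ge0 ?(le_trans t0) //; lra.
Qed.

(* The closed set of points of [C] at distance at least [e] from [q] stays
   strictly farther from [y] than [q]. *)
Lemma in_proj_cvg y q e : closed C -> in_proj C y q ->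
  (forall p, in_proj C y p -> p = q) -> 0 < e ->
  exists2 d, 0 < d &
    forall z p, enorm (z - y) < d -> in_proj C z p -> enorm (p - q) < e.
Proof.
move=> cC [Cq qmin] uq e0; pose far := C `&` ~` [set p | enorm (p - q) < e].
have cfar : closed far.
  apply: closedI => //; apply: open_closedC.
  have /continuousP/(_ _ (@open_lt R e)) := @enorm_sub_continuous R n q.
  exact.
have [[p0 farp0]|nfar] := pselect (far !=set0); last first.
  exists 1 => // z p _ [Cp _]; rewrite ltNge; apply/negP => ep.
  by apply: nfar; exists p; split=> //=; rewrite ltNge ep.
have [p' [[Cp' farp'] p'min]] := in_proj_exists y (ex_intro _ p0 farp0) cfar.
have gap : enorm (y - q) < enorm (y - p').
  rewrite lt_neqAle qmin // andbT; apply/eqP => qp'; apply: farp'.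
  rewrite (uq p') /= ?subrr ?enorm0 //; split=> // x Cx.
  by rewrite -qp'; exact: qmin.
exists ((enorm (y - p') - enorm (y - q)) / 2).
  by rewrite divr_gt0 ?subr_gt0.
move=> z p zy [Cp pmin]; rewrite ltNge; apply/negP => ep.
have /p'min : far p by split=> //=; rewrite ltNge ep.
have := enormB_triangle z y p; have := enormB_triangle y z q.
have := pmin q Cq; rewrite (enormBC y z); move: zy; lra.
Qed.

Definition edist z : R := inf [set enorm (z - y) | y in C].

Lemma edist_le z y : C y -> edist z <= enorm (z - y).
Proof.
move=> Cy; apply: ge_inf; last by exists y.
by exists 0 => _ [? _ <-]; exact: enorm_ge0.
Qed.

Lemma in_proj_edist z p : in_proj C z p -> edist z = enorm (z - p).
Proof.
move=> [Cp pmin]; apply/le_anti; rewrite edist_le //=.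
by apply: lb_le_inf => [|_ [y Cy <-]]; [eexists; exists p|exact: pmin].
Qed.

Lemma edist_continuous : C !=set0 -> continuous edist.
Proof.
move=> [a Ca]; apply: elipschitz_real_continuous; exists 1 => y z.
have edistD u v : edist u <= edist v + enorm (u - v).
  rewrite -lerBlDr; apply: lb_le_inf => [|_ [c Cc <-]].
    by eexists; exists a.
  by rewrite lerBlDr addrC (le_trans (edist_le _ Cc)) // enormB_triangle.
have := edistD y z; have := edistD z y.
by rewrite ler_norml (enormBC z) mul1r; lra.
Qed.

(* The derivative of the distance at [y] along [h] is
   [dotv h (y - q) / enorm (y - q)]. *)
Lemma edist_max_dotv_le0 y q h t0 : closed C -> in_proj C y q ->
  (forall p, in_proj C y p -> p = q) -> 0 < t0 ->
  (forall t, 0 < t <= t0 -> edist (y + t *: h) <= edist y) ->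
  dotv h (y - q) <= 0.
Proof.
move=> cC yq uq t00 ymax.
apply: (@ler_addM_small _ _ _ (enorm h) 1) => // e /andP[e0 _]; rewrite add0r.
have [d d0 near_q] := in_proj_cvg cC yq uq e0.
have h1 : 0 < enorm h + 1 by rewrite ltr_wpDl ?enorm_ge0.
pose t := Num.min t0 (d / (enorm h + 1)).
have tgt0 : 0 < t by rewrite lt_min t00 divr_gt0.
have [p yp] := in_proj_exists (y + t *: h) (ex_intro _ q yq.1) cC.
have pq : enorm (p - q) < e.
  apply: (near_q (y + t *: h)) => //.
  rewrite addrC addKr enormZ_ge0 ?(ltW tgt0) //.
  apply: (@lt_le_trans _ _ (t * (enorm h + 1))).
    by rewrite ltr_pM2l // ltrDl.
  by rewrite -ler_pdivlMr // ge_min lexx orbT.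
have dir_le0 : dotv h (y - p) <= 0.
  have := ymax t; rewrite tgt0 ge_min lexx /= => /(_ isT).
  rewrite (in_proj_edist yp) => /le_trans/(_ (edist_le y yp.1)).
  rewrite -(@ler_pXn2r _ 2) ?nnegrE ?enorm_ge0 // addrAC enorm_sqrD dotvZr.
  rewrite (dotvC _ h) -(pmulr_rle0 _ tgt0).
  have := sqr_ge0 (enorm (t *: h)); lra.
have -> : y - q = (y - p) + (p - q) by rewrite addrA subrK.
have := dotv_le h (p - q).
have : enorm h * enorm (p - q) <= e * enorm h.
  by rewrite mulrC ler_wpM2r ?enorm_ge0 // ltW.
by rewrite (dotvDr (y - p)); lra.
Qed.

Definition unique_proj (U : set 'rV[R]_n) : Prop :=
  forall z p q, U z -> in_proj C z p -> in_proj C z q -> p = q.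

Definition proximal_normal a w : Prop :=
  exists2 t, 0 < t & in_proj C (a + t *: w) a.

(* For each proximal normal [w] at [a], the ball of radius [r] touching [a] on
   the side of [w] has no point of [C] in its interior. *)
Definition reach_ge r a : Prop := forall w y, proximal_normal a w -> C y ->
  dotv w (y - a) <= enorm w / (2 * r) * enorm (y - a) ^+ 2.

Lemma edist_max_eball x e y q : closed C -> 0 <= e -> eball x e y ->
  (forall z, eball x e z -> edist z <= edist y) ->
  in_proj C y q -> (forall p, in_proj C y p -> p = q) -> y != q ->
  y - x = (e / enorm (y - q)) *: (y - q).
Proof.
move=> cC e0 xy ymax yq uq; rewrite -subr_eq0; set w := y - q => w0.
have d0 : 0 < enorm w by rewrite enorm_gt0.
pose h := x + (e / enorm w) *: w - y.
apply: dotv_max_colinear => //; suff : dotv h w <= 0.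
  have -> : dotv h w = e * enorm w - dotv (y - x) w.
    rewrite /h 2!dotvDl dotvNl dotvZl -enorm_sqr (dotvDl y) dotvNl.
    by field; rewrite gt_eqF.
  by rewrite subr_le0.
apply: (edist_max_dotv_le0 cC yq uq ltr01) => t /andP[/ltW t0 t1].
apply: ymax; rewrite /eball /=.
have -> : y + t *: h - x = (1 - t) *: (y - x) + t *: ((e / enorm w) *: w).
  by rewrite /h; apply/rowP => i; rewrite !mxE; ring.
apply: le_trans (enormD _ _) _.
rewrite !enormZ_ge0 ?subr_ge0 ?divr_ge0 ?(ltW d0) // divfK ?gt_eqF //.
have : (1 - t) * enorm (y - x) <= (1 - t) * e by rewrite ler_wpM2l ?subr_ge0.
lra.
Qed.

(* With [y] the point of the ball around [x] farthest from [C], [x] lies between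
   [y] and its projection [q], which is thus also the projection [a] of [x]. *)
Lemma in_proj_farthest x a e : closed C -> 0 < e <= enorm (x - a) ->
  unique_proj (eball x e) -> in_proj C x a ->
  exists y, [/\ in_proj C y a, enorm (x - a) <= enorm (y - a)
               & y - x = (e / enorm (y - a)) *: (y - a)].
Proof.
move=> cC /andP[e0 es] uniq xa.
have C0 : C !=set0 by exists a; exact: xa.1.
have xx : eball x e x by apply: eballxx; exact: ltW.
have [|||y] := @EVT_max_rV R n edist (eball x e).
- by exists x.
- by rewrite -[eball x e]setTI; apply: compact_eballI; exact: closedT.
- exact/continuous_subspaceT/edist_continuous.
rewrite inE => xy ymax.
have [q yq] := in_proj_exists y C0 cC.
have xa_le : enorm (x - a) <= enorm (y - q).
  by rewrite -(in_proj_edist xa) -(in_proj_edist yq) ymax // inE.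
have d0 : 0 < enorm (y - q) by rewrite (lt_le_trans e0) // (le_trans es).
have yE : y - x = (e / enorm (y - q)) *: (y - q).
  apply: edist_max_eball => // [|z xz|p yp|]; first exact: ltW.
  - by apply: ymax; rewrite inE.
  - exact: uniq xy yp yq.
  - by rewrite -subr_eq0 -enorm_gt0.
suff qa : q = a by rewrite qa in yq xa_le yE; exists y.
apply: (uniq x) => //.
have -> : x = q + (1 - e / enorm (y - q)) *: (y - q).
  by rewrite scalerBl scale1r -yE; apply/rowP => i; rewrite !mxE; ring.
apply: (@in_proj_ray _ _ 1); last by rewrite scale1r addrC subrK.
rewrite subr_ge0 ler_pdivrMr // mul1r (le_trans es) //=.
by rewrite gerBl divr_ge0 ?ltW.
Qed.

Lemma in_proj_extend a v s e : closed C -> enorm v = 1 -> 0 < e <= s ->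
  unique_proj (eball (a + s *: v) e) -> in_proj C (a + s *: v) a ->
  in_proj C (a + (s + e) *: v) a.
Proof.
move=> cC v1 /andP[e0 es]; set x := a + s *: v => uniq xa.
have s0 : 0 < s by exact: lt_le_trans es.
have xaE : x - a = s *: v by rewrite /x addrC addKr.
have xa_norm : enorm (x - a) = s by rewrite xaE enormZ_ge0 ?v1 ?mulr1 ?ltW.
have [|y [ya]] := in_proj_farthest (e := e) cC _ uniq xa.
  by rewrite e0 xa_norm.
rewrite xa_norm; set w := y - a; set d := enorm w => sd yE.
have d0 : 0 < d by exact: lt_le_trans sd.
have svE : s *: v = (1 - e / d) *: w.
  rewrite -xaE scalerBl scale1r -yE /w.
  by apply/rowP => i; rewrite !mxE; ring.
have dE : d = s + e.
  have := congr1 (@enorm R n) svE; rewrite !enormZ_ge0 ?(ltW s0) //; last first.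
    by rewrite subr_ge0 ler_pdivrMr // mul1r (le_trans es).
  rewrite v1 mulr1 -/d mulrBl mul1r divfK ?gt_eqF // => ->.
  by rewrite subrK.
suff -> : (s + e) *: v = w by rewrite /w addrC subrK.
apply: (scalerI (lt0r_neq0 s0)).
rewrite scalerA mulrC -scalerA svE scalerA -dE; congr (_ *: _).
by rewrite mulrBr mulr1 mulrCA mulfV ?gt_eqF // mulr1 dE addrK.
Qed.

Lemma proximal_normal_in_proj a v r : closed C -> enorm v = 1 -> 0 < r ->
  unique_proj (eball a r) -> proximal_normal a v -> in_proj C (a + r *: v) a.
Proof.
move=> cC v1 r0 uniq [t t0 ta].
pose radii := [set s | 0 < s <= r /\ in_proj C (a + s *: v) a].
have radii_double s : radii s -> radii (Num.min (2 * s) r).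
  move=> [/andP[s0 sr] sa]; have [<-|sNr] := eqVneq s r.
    rewrite (min_idPr _) ?ler_peMl ?(ltW s0) ?ler1n //.
    by split; rewrite ?s0 ?lexx.
  split.
    by rewrite lt_min mulr_gt0 //= (lt_le_trans s0) //= ge_min lexx orbT.
  rewrite -[Num.min _ _](subrKC s); apply: in_proj_extend => //.
    have s_lt_r : s < r by rewrite lt_neqAle sNr.
    rewrite subr_gt0 lt_min s_lt_r andbT ltr_pMl ?ltr1n //.
    by rewrite lerBlDl ge_min mulr_natl mulr2n lexx.
  move=> z p q zs; apply: uniq; rewrite /eball /=.
  apply: le_trans (enormB_triangle (a + s *: v) _ _) _.
  rewrite [X in _ + enorm X]addrC addKr enormZ_ge0 ?(ltW s0) // v1 mulr1.
  by rewrite -lerBrDr (le_trans zs) // lerB // ge_min lexx orbT.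
have radii_t : radii (Num.min t r).
  split; first by rewrite lt_min t0 r0 ge_min lexx orbT.
  by apply: in_proj_ray ta; rewrite le_min (ltW t0) (ltW r0) /= ge_min lexx.
have sup_radii : has_sup radii.
  by split; [exists (Num.min t r)|exists r => s [/andP[_ ?] _]].
have sup0 : 0 < sup radii.
  apply: lt_le_trans (sup_upper_bound sup_radii radii_t).
  by have [/andP[]] := radii_t.
have [|s radii_s] := @sup_adherent _ radii (sup radii / 2) _ sup_radii.
  by rewrite divr_gt0.
have [_ dbl_proj] := radii_double s radii_s.
have dbl_le : Num.min (2 * s) r <= sup radii.
  exact: sup_upper_bound (radii_double s radii_s).
move=> half_s; suff /min_idPr <- : r <= 2 * s by [].
move: dbl_le; rewrite ge_min => /orP[|/le_trans]; last apply; move: half_s; lra.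
Qed.

Lemma unique_proj_reach_ge a r : closed C -> 0 < r ->
  unique_proj (eball a r) -> reach_ge r a.
Proof.
move=> cC r0 uniq w y [t t0 ta] Cy.
have [->|] := eqVneq w 0; first by rewrite dotv0l enorm0 !mul0r.
rewrite -enorm_gt0 => w0.
have [||_ /(_ y Cy)] :=
    @proximal_normal_in_proj a ((enorm w)^-1 *: w) r cC _ r0 uniq.
- by rewrite enormZ_ge0 ?invr_ge0 ?(ltW w0) // mulVf ?gt_eqF.
- by exists (t * enorm w); rewrite ?mulr_gt0 // scalerA mulfK ?gt_eqF.
rewrite (addrC a) addrK -addrA -(opprB y a).
rewrite -(@ler_pXn2r _ 2) ?nnegrE ?enorm_ge0 // (enorm_sqrB (_ *: _)) !dotvZl.
move=> sq_le.
have -> : enorm w / (2 * r) * enorm (y - a) ^+ 2 =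
    dotv w (y - a) + enorm w / (2 * r) *
    (enorm (y - a) ^+ 2 - 2 * (r * ((enorm w)^-1 * dotv w (y - a)))).
  by field; rewrite !gt_eqF.
rewrite lerDl mulr_ge0 ?divr_ge0 ?mulr_ge0 ?(ltW r0) ?enorm_ge0 //; lra.
Qed.

Lemma prox_regular_reach_ge xs : closed C -> prox_regular C -> C xs ->
  exists2 r, 0 < r & forall a, eball xs r a -> reach_ge r a.
Proof.
move=> cC [U [oU [CU uniq]]] Cxs.
have /nbhs_enormP[d d0 dU] : nbhs xs U.
  by apply: open_nbhs_nbhs; split=> //; exact: CU.
exists (d / 3) => [|a axs]; first by rewrite divr_gt0.
apply: unique_proj_reach_ge => // [|z p q za]; first by rewrite divr_gt0.
apply/uniq/dU; have := enormB_triangle a z xs.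
by move: za axs d0; rewrite /eball /=; lra.
Qed.

End Projection.

Section DotvLinear.
Variables (R : realType) (n : nat) (u : 'rV[R]_n).

Fact dotv_linear : linear (dotv u : 'rV[R]_n -> R).
Proof. by move=> a v w; rewrite dotvDr dotvZr. Qed.

HB.instance Definition _ :=
  GRing.isLinear.Build R 'rV[R]_n R _ (dotv u) dotv_linear.

Lemma dotv_continuous : continuous (dotv u : 'rV[R]_n -> R).
Proof.
apply: elipschitz_real_continuous; exists (enorm u) => x y.
by rewrite -dotvNr -dotvDr dotv_norm_le.
Qed.

Lemma dotv_differentiable v : differentiable (dotv u : 'rV[R]_n -> R) v.
Proof. exact/linear_differentiable/dotv_continuous. Qed.

Lemma diff_dotv v : 'd (dotv u : 'rV[R]_n -> R) v = dotv u :> ('rV[R]_n -> R).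
Proof. exact/diff_lin/dotv_continuous. Qed.

Lemma dotv_delta i : dotv u (delta_mx ord0 i) = u ord0 i.
Proof.
rewrite /dotv (bigD1 i) //= mxE !eqxx mulr1 big1 ?addr0 // => j ji.
by rewrite mxE eqxx (negbTE ji) mulr0.
Qed.

End DotvLinear.

Section Adjoint.
Variables (R : realType) (n k : nat) (A : 'M[R]_(n, k)).

Lemma dotv_mulmx_tr (u : 'rV[R]_k) (v : 'rV[R]_n) :
  dotv (u *m A^T) v = dotv u (v *m A).
Proof.
have dotv_mx m (x y : 'rV[R]_m) : dotv x y = (x *m y^T) ord0 ord0.
  by rewrite mxE; apply: eq_bigr => i _; rewrite mxE.
by rewrite !dotv_mx trmx_mul mulmxA.
Qed.

Lemma enorm_mulmx_tr_le (u : 'rV[R]_k) (L : R) : 0 <= L ->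
  (forall v, enorm (v *m A) <= L * enorm v) ->
  enorm (u *m A^T) <= L * enorm u.
Proof.
move=> L0 AL; apply: enorm_le_dual => [|v].
  by rewrite mulr_ge0 ?enorm_ge0.
rewrite dotv_mulmx_tr; apply: le_trans (dotv_le _ _) _.
by rewrite mulrC mulrAC ler_wpM2r ?enorm_ge0.
Qed.

End Adjoint.

Lemma is_derive_line (R : numFieldType) (V W : normedModType R) (f : V -> W)
    (x h : V) (t : R) : differentiable f (x + t *: h) ->
  is_derive t 1 (fun s => f (x + s *: h)) ('d f (x + t *: h) h).
Proof.
move=> df.
have dline : is_diff (t : R^o) (cst x + *:%R^~ h) (0 + *:%R^~ h).
  exact: is_diffD.
have dcomp := is_diff_comp dline (differentiableP df).
apply: DeriveDef; first exact: diff_derivable.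
by rewrite deriveE // diff_val /= !fctE add0r scale1r.
Qed.

Section SmoothMap.
Variables (R : realType) (n k : nat) (f : 'rV[R]_n -> 'rV[R]_k).

Lemma enorm_diff_le (L : R) x v : differentiable f x ->
  (forall y z, enorm (f y - f z) <= L * enorm (y - z)) ->
  enorm ('d f x v) <= L * enorm v.
Proof.
move=> df fL; rewrite -deriveE //.
suff : eball 0 (L * enorm v) ('D_v f x) by rewrite /eball /= subr0.
apply: (@closed_cvg _ _ _ _ _ _ (@closed_eball _ _ _ _) _ _
  (diff_derivable df)).
near=> t; rewrite /eball /= subr0 enormZ normfV ler_pdivrMl; last first.
  by rewrite normr_gt0; near: t; exact: nbhs_dnbhs_neq.
by rewrite mulrCA -enormZ; apply: le_trans (fL _ _) _; rewrite addrK.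
Unshelve. all: by end_near. Qed.

Lemma taylor1_le (L : R) x y : (forall z, differentiable f z) -> 0 <= L ->
  (forall z v, enorm ('d f z v - 'd f x v) <= L * enorm (z - x) * enorm v) ->
  enorm (f y - f x - 'd f x (y - x)) <= L * enorm (y - x) ^+ 2.
Proof.
move=> df L0 dfL; set h := y - x.
apply: enorm_le_dual => [|u]; first by rewrite mulr_ge0 ?sqr_ge0.
have du (t : R) : is_derive t 1 (fun s => dotv u (f (x + s *: h)))
                          (dotv u ('d f (x + t *: h) h)).
  have df' : differentiable (dotv u \o f) (x + t *: h).
    by apply: differentiable_comp => //; exact: dotv_differentiable.
  have := is_derive_line df'.
  by rewrite diff_comp ?diff_dotv //; exact: dotv_differentiable.
have [|t /[!in_itv]/= /andP[t0 t1]] := @MVT R _ _ 0 1 ltr01 (fun t _ => du t).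
  by apply: derivable_within_continuous => t _; have [] := du t.
rewrite scale1r scale0r addr0 subr0 mulr1 {1}/h subrKC => fE.
rewrite dotvC dotvDr dotvNr (dotvDr (f y)) dotvNr fE -dotvNr -dotvDr.
apply: le_trans (dotv_le _ _) _.
rewrite mulrC ler_wpM2r ?enorm_ge0 //; apply: le_trans (dfL _ _) _.
rewrite (addrC x) addrK enormZ_ge0 ?(ltW t0) // expr2 [leRHS]mulrA.
rewrite ler_wpM2r ?enorm_ge0 //.
by rewrite ler_wpM2l // ler_piMl ?enorm_ge0 // ltW.
Qed.

End SmoothMap.

Definition quad_minorant (R : realType) n (K : R) (f : 'rV[R]_n -> R)
    (x u : 'rV[R]_n) : Prop :=
  forall y, f x + dotv u (y - x) - K * enorm (y - x) ^+ 2 <= f y.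

Definition quad_majorant (R : realType) n (K : R) (f : 'rV[R]_n -> R)
    (x u : 'rV[R]_n) : Prop :=
  forall y, f y <= f x + dotv u (y - x) + K * enorm (y - x) ^+ 2.

Section QuadraticBounds.
Variables (R : realType) (n : nat) (f : 'rV[R]_n -> R) (x u : 'rV[R]_n).
Implicit Types (v : 'rV[R]_n) (K : R).

Lemma quad_minorant_weaken K K' : K <= K' ->
  quad_minorant K f x u -> quad_minorant K' f x u.
Proof.
move=> KK' fK y; apply: le_trans (fK y).
by rewrite lerD2l lerN2 ler_wpM2r ?sqr_ge0.
Qed.

Lemma quad_majorant_weaken K K' : K <= K' ->
  quad_majorant K f x u -> quad_majorant K' f x u.
Proof.
by move=> KK' fK y; apply: le_trans (fK y) _; rewrite lerD2l ler_wpM2r ?sqr_ge0.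
Qed.

Lemma quad_bounds_grad K K' :
  quad_minorant K f x u -> quad_majorant K' f x u -> grad f x = u.
Proof.
move=> fK fK'; apply/rowP => i; rewrite mxE.
suff -> : 'd f x = dotv u :> ('rV[R]_n -> R) by exact: dotv_delta.
apply: diff_unique; first exact: dotv_continuous.
apply/eqaddoP => e e0; pose M := Num.max `|K| `|K'|.
have M0 : 0 <= M by rewrite le_max normr_ge0.
have M1 : 0 < M * n%:R ^+ 2 + 1 by rewrite ltr_wpDl // mulr_ge0.
apply/nbhs_ballP.
exists (e / (M * n%:R ^+ 2 + 1)) => /= [|h]; first exact: divr_gt0.
rewrite -ball_normE /= sub0r normrN ltr_pdivlMr // => hM.
have -> : ((f \o shift x) - (cst (f x) + dotv u)) h
    = f (h + x) - f x - dotv u h.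
  by rewrite !fctE opprD addrA.
apply: (@le_trans _ _ (M * (n%:R * `|h|) ^+ 2)); last first.
  rewrite exprMn (expr2 `|h|) !mulrA ler_wpM2r //.
  have := normr_ge0 h; move: hM; lra.
apply: (@le_trans _ _ (M * enorm h ^+ 2)); last first.
  rewrite ler_wpM2l // ler_pXn2r ?nnegrE ?enorm_ge0 ?mulr_ge0 //.
  exact: enorm_le_normr.
have MK : - (M * enorm h ^+ 2) <= - (K * enorm h ^+ 2).
  by rewrite lerN2 ler_wpM2r ?sqr_ge0 // le_max ler_norm.
have MK' : K' * enorm h ^+ 2 <= M * enorm h ^+ 2.
  by rewrite ler_wpM2r ?sqr_ge0 // le_max ler_norm orbT.
have := fK (h + x); have := fK' (h + x); rewrite addrK ler_norml.
by move: MK MK'; lra.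
Qed.

Lemma quad_majorant_frechet_subdiff K v :
  quad_majorant K f x u -> frechet_subdiff (EFin \o f) x v -> v = u.
Proof.
move=> fK [_ fv]; apply/eqP; rewrite -subr_eq0 -enorm_eq0 -sqrf_eq0.
rewrite eq_le sqr_ge0 andbT; set h := v - u.
apply: (@ler_addM_small _ _ _ (enorm h) 1) => // d /andP[d0 _]; rewrite add0r.
have [->|h0] := eqVneq h 0; first by rewrite enorm0 expr0n mulr0.
rewrite -enorm_gt0 in h0; have [e [e0 fe]] := fv d d0.
have t00 : 0 < e / 2 / enorm h by rewrite !divr_gt0.
apply: (@ler_addM_small _ _ _ (K * enorm h ^+ 2) _ t00) => t /andP[t0].
rewrite ler_pdivlMr // => te.
have := fK (x + t *: h); have := fe (x + t *: h).
rewrite [x + _]addrC addrK enormZ_ge0 ?(ltW t0) // mulr_gt0 //=.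
have -> : t * enorm h < e.
  by apply: le_lt_trans te _; rewrite ltr_pdivrMr ?ltr_pMr ?ltr1n.
move=> /(_ isT); rewrite -!EFinB lee_fin => ge_v le_u.
have hE : enorm h ^+ 2 = dotv v h - dotv u h.
  by rewrite enorm_sqr {1}/h dotvDl dotvNl.
rewrite -(ler_pM2l t0) {1}hE; move: ge_v le_u; rewrite !dotvZr; lra.
Qed.

End QuadraticBounds.

Lemma quad_minorant_frechet_subdiff (R : realType) n (J : 'rV[R]_n -> \bar R)
    (r K : R) x u : J x = r%:E ->
  (forall y, ((r + dotv u (y - x) - K * enorm (y - x) ^+ 2)%:E <= J y)%E) ->
  frechet_subdiff J x u.
Proof.
move=> Jx JK; split=> [|d d0]; first by rewrite Jx.
have K0 : 0 < `|K| + 1 by rewrite ltr_wpDl.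
exists (d / (`|K| + 1)); split=> [|y /andP[y0]]; first exact: divr_gt0.
rewrite ltr_pdivlMr // Jx => yd; case: (J y) (JK y) => [s||//]; last first.
  by move=> _; rewrite -!EFinN !addye // leey.
rewrite -!EFinB !lee_fin.
have := ler_norm1M (enorm_ge0 (y - x)) (lexx (K * enorm (y - x))).
rewrite [leRHS]mulrC => /le_trans/(_ (ltW yd))/(ler_wpM2r (enorm_ge0 (y - x))).
by rewrite -mulrA -expr2; lra.
Qed.

Section QuadraticComposition.
Variables (R : realType) (n k : nat) (S : 'rV[R]_n -> 'rV[R]_k) (LS LD : R).
Hypothesis dS : forall y, differentiable S y.
Hypothesis SL : forall x y, enorm (S x - S y) <= LS * enorm (x - y).
Hypothesis LD0 : 0 <= LD.
Hypothesis DSL : forall x y v,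
  enorm ('d S x v - 'd S y v) <= LD * enorm (x - y) * enorm v.
Implicit Types (x y : 'rV[R]_n) (w : 'rV[R]_k) (h : 'rV[R]_k -> R) (K : R).

Lemma diffEjacobian x v : 'd S x v = v *m 'J S x.
Proof. by rewrite /jacobian mul_rV_lin1. Qed.

Lemma dotv_adjoint_taylor1 w x y :
  `|dotv w (S y - S x) - dotv (w *m ('J S x)^T) (y - x)|
    <= enorm w * LD * enorm (y - x) ^+ 2.
Proof.
rewrite dotv_mulmx_tr -diffEjacobian -dotvNr -dotvDr.
apply: le_trans (dotv_norm_le _ _) _; rewrite -mulrA ler_wpM2l ?enorm_ge0 //.
exact: taylor1_le.
Qed.

Lemma enorm_sqr_lipschitz x y :
  enorm (S x - S y) ^+ 2 <= LS ^+ 2 * enorm (x - y) ^+ 2.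
Proof.
have SLxy := SL x y; rewrite -exprMn ler_pXn2r ?nnegrE ?enorm_ge0 //.
exact: le_trans (enorm_ge0 _) SLxy.
Qed.

Lemma quad_minorant_comp h K x w : 0 <= K -> quad_minorant K h (S x) w ->
  quad_minorant (enorm w * LD + K * LS ^+ 2) (fun y => h (S y)) x
    (w *m ('J S x)^T).
Proof.
move=> K0 hK y; apply: le_trans (hK (S y)).
have := ler_wpM2l K0 (enorm_sqr_lipschitz y x).
have := dotv_adjoint_taylor1 w x y; rewrite ler_norml; lra.
Qed.

Lemma quad_majorant_comp h K x w : 0 <= K -> quad_majorant K h (S x) w ->
  quad_majorant (enorm w * LD + K * LS ^+ 2) (fun y => h (S y)) x
    (w *m ('J S x)^T).
Proof.
move=> K0 hK y; apply: le_trans (hK (S y)) _.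
have := ler_wpM2l K0 (enorm_sqr_lipschitz y x).
have := dotv_adjoint_taylor1 w x y; rewrite ler_norml; lra.
Qed.

End QuadraticComposition.

Lemma weakly_convex_le (R : realType) n (eta : R) (g : 'rV[R]_n -> R) x y t :
  weakly_convex eta g -> 0 <= t <= 1 ->
  g (t *: x + (1 - t) *: y) <=
    t * g x + (1 - t) * g y + eta / 2 * (t * (1 - t) * enorm (x - y) ^+ 2).
Proof. by move=> /(_ x y t)/[apply]; rewrite enorm_sqr_conv; lra. Qed.

Definition is_prox (R : realType) n (mu : R) (g : 'rV[R]_n -> R)
    (z p : 'rV[R]_n) : Prop :=
  forall w, g p + (2 * mu)^-1 * enorm (p - z) ^+ 2
            <= g w + (2 * mu)^-1 * enorm (w - z) ^+ 2.

Section MoreauEnvelope.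
Variables (R : realType) (n : nat) (g : 'rV[R]_n -> R) (L eta : R).
Hypothesis L0 : 0 < L.
Hypothesis gL : forall x y, `|g x - g y| <= L * enorm (x - y).
Hypothesis gconv : weakly_convex eta g.
Implicit Types (z w p q : 'rV[R]_n) (mu : R).

Lemma lipschitz_ge w z : g z - L * enorm (w - z) <= g w.
Proof. have := gL w z; rewrite ler_norml; lra. Qed.

Lemma is_prox_exists mu z : 0 < mu -> exists p, is_prox mu g z p.
Proof.
move=> mu0; pose r := 2 * mu * L.
have r0 : 0 < r by rewrite !mulr_gt0.
have m0 : 0 < (2 * mu)^-1 by rewrite invr_gt0 mulr_gt0.
have zr : eball z r z by apply: eballxx; exact: ltW.
have [|||p] := @EVT_min_rV R n (fun w => g w + (2 * mu)^-1 * enorm (w - z) ^+ 2)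
    (eball z r).
- by exists z.
- by rewrite -[eball z r]setTI; apply: compact_eballI; exact: closedT.
- apply: continuous_subspaceT => w; apply: (continuousD (f := g)).
    by apply: elipschitz_real_continuous; exists L.
  apply: (continuousM (s := cst _)); first exact: cst_continuous.
  exact: (continuous_comp (@enorm_sub_continuous R n z w)
    (@exprn_continuous R 2 _)).
rewrite inE => _ pmin; exists p => w.
have [wr|wr] := leP (enorm (w - z)) r; first by apply: pmin; rewrite inE.
apply: le_trans (pmin z _) _; first by rewrite inE.
rewrite subrr enorm0 expr0n mulr0 addr0.
have far_gain : L * enorm (w - z) <= (2 * mu)^-1 * enorm (w - z) ^+ 2.
  rewrite expr2 mulrA ler_wpM2r ?enorm_ge0 // ler_pdivlMl ?mulr_gt0 //.
  exact: ltW.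
have := lipschitz_ge w z; lra.
Qed.

Lemma moreauE mu z p : is_prox mu g z p ->
  moreau mu g z = g p + (2 * mu)^-1 * enorm (p - z) ^+ 2.
Proof.
move=> zp; apply/le_anti/andP; split.
  apply: ge_inf; last by exists p.
  by exists (g p + (2 * mu)^-1 * enorm (p - z) ^+ 2) => _ [w _ <-]; exact: zp.
apply: lb_le_inf; first by eexists; exists p.
by move=> _ [w _ <-]; exact: zp.
Qed.

Lemma le_moreau mu z a :
  (forall w, a <= g w + (2 * mu)^-1 * enorm (w - z) ^+ 2) -> a <= moreau mu g z.
Proof.
by move=> le_a; apply: lb_le_inf => [|_ [w _ <-]//]; eexists; exists 0.
Qed.

Lemma moreau_le mu z w : 0 < mu ->
  moreau mu g z <= g w + (2 * mu)^-1 * enorm (w - z) ^+ 2.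
Proof.
move=> mu0; have [p zp] := is_prox_exists z mu0.
by rewrite (moreauE zp); exact: zp.
Qed.

Lemma moreau_le_fun mu z : 0 < mu -> moreau mu g z <= g z.
Proof.
move=> mu0; have := moreau_le z z mu0.
by rewrite subrr enorm0 expr0n mulr0 addr0.
Qed.

Lemma linear_sub_quad_le mu d : 0 < mu ->
  L * d - (2 * mu)^-1 * d ^+ 2 <= L ^+ 2 / 2 * mu.
Proof.
move=> mu0; rewrite -subr_ge0.
have -> : L ^+ 2 / 2 * mu - (L * d - (2 * mu)^-1 * d ^+ 2) =
    (2 * mu)^-1 * (mu * L - d) ^+ 2 by field; rewrite gt_eqF.
by rewrite mulr_ge0 ?sqr_ge0 // invr_ge0 mulr_ge0 // ltW.
Qed.

Lemma moreau_ge mu z : 0 < mu -> g z - L ^+ 2 / 2 * mu <= moreau mu g z.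
Proof.
move=> mu0; apply: le_moreau => w.
have := linear_sub_quad_le (enorm (w - z)) mu0; have := lipschitz_ge w z; lra.
Qed.

Lemma moreau_decr mu mu' z : 0 < mu' -> mu' <= mu ->
  moreau mu' g z <= moreau mu g z + L ^+ 2 / 2 * (mu - mu').
Proof.
move=> mu'0 mu'mu; have mu0 := lt_le_trans mu'0 mu'mu.
have [p zp] := is_prox_exists z mu0; rewrite (moreauE zp).
pose t := mu' / mu; pose w := z + t *: (p - z).
have t0 : 0 <= t by rewrite divr_ge0 // ltW.
have t1 : 0 <= 1 - t by rewrite subr_ge0 ler_pdivrMr // mul1r.
apply: le_trans (moreau_le z w mu'0) _.
have -> : enorm (w - z) = t * enorm (p - z).
  by rewrite /w addrC addKr enormZ_ge0.
have gw : g w <= g p + L * ((1 - t) * enorm (p - z)).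
  have := lipschitz_ge p w.
  have -> : p - w = (1 - t) *: (p - z); last by rewrite enormZ_ge0 //; lra.
  by rewrite /w; apply/rowP => i; rewrite !mxE; ring.
have := ler_wpM2l t1 (linear_sub_quad_le (enorm (p - z)) mu0).
have -> : (2 * mu')^-1 * (t * enorm (p - z)) ^+ 2 =
    t * ((2 * mu)^-1 * enorm (p - z) ^+ 2).
  by rewrite /t; field; rewrite !gt_eqF.
have -> : (1 - t) * (L ^+ 2 / 2 * mu) = L ^+ 2 / 2 * (mu - mu').
  by rewrite /t; field; rewrite gt_eqF.
move: gw; lra.
Qed.

Lemma prox_grad_le mu z p : 0 < mu -> is_prox mu g z p ->
  enorm (mu^-1 *: (z - p)) <= 2 * L.
Proof.
move=> mu0 /(_ z); rewrite subrr enorm0 expr0n mulr0 addr0.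
rewrite enormZ_ge0 ?invr_ge0 ?(ltW mu0) // (enormBC z) ler_pdivrMl //.
have := lipschitz_ge p z; set d := enorm (p - z) => g_ge g_le.
have [->|dN0] := eqVneq d 0; first by rewrite !mulr_ge0 // ltW.
have d0 : 0 < d by rewrite lt_def dN0 enorm_ge0.
rewrite -(ler_pM2r d0) -expr2.
have -> : mu * (2 * L) * d = 2 * mu * (L * d) by ring.
by rewrite -ler_pdivrMl ?mulr_gt0 //; move: g_ge g_le; lra.
Qed.

Lemma prox_subgradient mu z p : 0 < mu -> is_prox mu g z p ->
  quad_minorant (eta / 2) g p (mu^-1 *: (z - p)).
Proof.
move=> mu0 zp w; set u := _ *: _; set N := enorm (w - p) ^+ 2.
pose m := (2 * mu)^-1.
apply: (@ler_addM_small _ _ _ ((m - eta / 2) * N) 1) => // t /andP[t0 t1].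
have := zp (t *: w + (1 - t) *: p).
have -> : t *: w + (1 - t) *: p - z = (p - z) + t *: (w - p).
  by apply/rowP => i; rewrite !mxE; ring.
rewrite (enorm_sqrD (p - z)) enormZ_ge0 ?(ltW t0) // exprMn -/N -/m dotvZr.
have -> : m * (enorm (p - z) ^+ 2 + 2 * (t * dotv (p - z) (w - p))
      + t ^+ 2 * N) =
    m * enorm (p - z) ^+ 2 - t * dotv u (w - p) + t ^+ 2 * (m * N).
  by rewrite /u /m dotvZl -(opprB z p) dotvNl; field; rewrite gt_eqF.
have t01 : 0 <= t <= 1 by rewrite (ltW t0).
have := weakly_convex_le w p gconv t01; rewrite -/N => g_conv p_min.
by rewrite -(ler_pM2l t0); move: g_conv p_min; lra.
Qed.

(* With [s := (q - z') + (z - p)], adding the proximal term of [q] to the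
   subgradient inequality at [p] leaves the square [(2 * mu)^-1 * |s| ^+ 2],
   which absorbs the defect of convexity because [q - p = s + (z' - z)]. *)
Lemma moreau_quad_minorant mu z p : 0 <= eta -> 0 < mu -> 2 * eta * mu <= 1 ->
  is_prox mu g z p -> quad_minorant eta (moreau mu g) z (mu^-1 *: (z - p)).
Proof.
move=> eta0 mu0 etamu zp z'; apply: le_moreau => q.
set d := z' - z; pose s := (q - z') + (z - p); pose m := (2 * mu)^-1.
have := prox_subgradient mu0 zp q; rewrite (moreauE zp) -/m.
have -> : q - p = s + d by rewrite /s /d; apply/rowP => i; rewrite !mxE; ring.
have -> : m * enorm (q - z') ^+ 2 = m * enorm s ^+ 2
    - dotv (mu^-1 *: (z - p)) s + m * enorm (p - z) ^+ 2.
  have -> : q - z' = s - (z - p) by rewrite addrK.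
  rewrite enorm_sqrB (enormBC p) dotvZl (dotvC s) /m.
  by field; rewrite gt_eqF.
have : eta / 2 * enorm (s + d) ^+ 2 <= eta * enorm s ^+ 2 + eta * enorm d ^+ 2.
  have := ler_wpM2l eta0 (enorm_sqrD_le s d); lra.
have : eta * enorm s ^+ 2 <= m * enorm s ^+ 2.
  rewrite ler_wpM2r ?sqr_ge0 // /m -[leRHS]mulr1 ler_pdivlMl ?mulr_gt0 //.
  by rewrite mulrAC.
by rewrite (dotvDr s); lra.
Qed.

Lemma moreau_quad_majorant mu z p : 0 < mu -> is_prox mu g z p ->
  quad_majorant (2 * mu)^-1 (moreau mu g) z (mu^-1 *: (z - p)).
Proof.
move=> mu0 zp z'; rewrite (moreauE zp).
apply: le_trans (moreau_le z' p mu0) _.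
have -> : p - z' = (p - z) - (z' - z) by rewrite opprB addrA subrK.
rewrite (enorm_sqrB (p - z)) -(opprB p z) dotvZl dotvNl invfM; lra.
Qed.

End MoreauEnvelope.

Section SmoothedComposition.
Variables (R : realType) (n k : nat) (S : 'rV[R]_n -> 'rV[R]_k).
Variables (g : 'rV[R]_k -> R) (L LS LD eta mu : R).
Hypothesis dS : forall y, differentiable S y.
Hypothesis LS0 : 0 < LS.
Hypothesis SL : forall x y, enorm (S x - S y) <= LS * enorm (x - y).
Hypothesis LD0 : 0 < LD.
Hypothesis DSL : forall x y v,
  enorm ('d S x v - 'd S y v) <= LD * enorm (x - y) * enorm v.
Hypothesis L0 : 0 < L.
Hypothesis gL : forall x y, `|g x - g y| <= L * enorm (x - y).
Hypothesis eta0 : 0 < eta.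
Hypothesis gconv : weakly_convex eta g.
Hypothesis mu0 : 0 < mu.
Hypothesis etamu : 2 * eta * mu <= 1.

Let F y := moreau mu g (S y).

Definition lower_curvature : R := 2 * L * LD + eta * LS ^+ 2.

Definition upper_curvature : R := L * LD / eta + LS ^+ 2 / 2.

Lemma upper_curvature_gt0 : 0 < upper_curvature.
Proof. by rewrite addr_gt0 // divr_gt0 ?exprn_gt0 // mulr_gt0. Qed.

Lemma smoothed_quad_bounds x :
  [/\ quad_minorant lower_curvature F x (grad F x),
      quad_majorant (upper_curvature / mu) F x (grad F x)
    & enorm (grad F x) <= 2 * L * LS].
Proof.
have [p xp] := is_prox_exists L0 gL (S x) mu0.
pose w := mu^-1 *: (S x - p).
have wL : enorm w <= 2 * L by exact: prox_grad_le xp.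
have wLD : enorm w * LD <= 2 * L * LD by rewrite ler_wpM2r // ltW.
have lower : quad_minorant lower_curvature F x (w *m ('J S x)^T).
  apply: (@quad_minorant_weaken _ _ _ _ _ (enorm w * LD + eta * LS ^+ 2)).
    by rewrite lerD2r.
  apply: quad_minorant_comp => //; try exact: ltW.
  by apply: moreau_quad_minorant => //; exact: ltW.
have upper : quad_majorant (upper_curvature / mu) F x (w *m ('J S x)^T).
  apply: (@quad_majorant_weaken _ _ _ _ _
    (enorm w * LD + (2 * mu)^-1 * LS ^+ 2)).
    have -> : upper_curvature / mu =
        2 * L * LD / (2 * eta * mu) + (2 * mu)^-1 * LS ^+ 2.
      by rewrite /upper_curvature; field; rewrite !gt_eqF.
    rewrite lerD2r (le_trans wLD) // ler_pdivlMr ?mulr_gt0 //.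
    by rewrite ler_piMr ?mulr_ge0 // ltW.
  apply: quad_majorant_comp => //; first exact: ltW.
    by rewrite invr_ge0 mulr_ge0 // ltW.
  by apply: (moreau_quad_majorant L0 gL).
rewrite (quad_bounds_grad lower upper); split=> //.
rewrite mulrC; apply: le_trans (enorm_mulmx_tr_le (L := LS) _ _ _) _ => [|v|].
- exact: ltW.
- by rewrite -diffEjacobian; exact: enorm_diff_le.
- by rewrite ler_pM2l.
Qed.

End SmoothedComposition.

Definition step_residual (R : realType) n (gam : R) (x p : 'rV[R]_n) : R :=
  enorm (gam^-1 *: (x - p)).

Lemma MstatE (R : realType) n (K K' gam : R) (f : 'rV[R]_n -> R) C x :
  quad_minorant K f x (grad f x) -> quad_majorant K' f x (grad f x) ->
  Mstat gam (fun y => (f y)%:E) C x =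
  ereal_inf [set (step_residual gam x p)%:E
    | p in in_proj C (x - gam *: grad f x)].
Proof.
move=> minor major; rewrite /Mstat; congr (ereal_inf (_ @` _)).
apply/seteqP; split=> [p [v [fv xp]]|p xp].
  by rewrite -(quad_majorant_frechet_subdiff major fv).
exists (grad f x); split=> //.
exact: (quad_minorant_frechet_subdiff (r := f x) (K := K)).
Qed.

Definition armijo_decrease (R : realType) n (f : 'rV[R]_n -> R) (c gam : R)
    (x y : 'rV[R]_n) : Prop :=
  f y <= f x - c * gam * step_residual gam x y ^+ 2.

Lemma projected_step_armijo (R : realType) n (f : 'rV[R]_n -> R) C
    (K c gam : R) x u y : quad_majorant K f x u -> C x -> 0 < gam ->
  gam * K <= 2^-1 - c -> in_proj C (x - gam *: u) y ->
  armijo_decrease f c gam x y.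
Proof.
move=> fK Cx gam0 gamK [Cy /(_ x Cx)]; rewrite /armijo_decrease /step_residual.
rewrite -(@ler_pXn2r _ 2) ?nnegrE ?enorm_ge0 //.
rewrite [x - _ - x]addrAC subrr add0r enormN [x - _ - y]addrAC.
rewrite (enorm_sqrB (x - y)) dotvZr (dotvC _ u).
rewrite [enorm (gam^-1 *: _)]enormZ_ge0 ?invr_ge0 ?(ltW gam0) //.
have := fK y; rewrite (enormBC y) -(opprB x y) dotvNr.
set d := dotv u _; set N := enorm (x - y) => f_le closer.
have -> : c * gam * (gam^-1 * N) ^+ 2 = gam^-1 * (c * N ^+ 2).
  by field; rewrite gt_eqF.
rewrite -(ler_pM2l gam0) mulrBr mulrA mulfV ?gt_eqF // mul1r.
have := ler_wpM2l (ltW gam0) f_le; have := ler_wpM2r (sqr_ge0 N) gamK.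
have := sqr_ge0 (enorm (gam *: u)); move: closer; lra.
Qed.

Definition backtracking_step (R : realType) n (C : set 'rV[R]_n)
    (f : 'rV[R]_n -> R) (c rho gt : R) (x : 'rV[R]_n) (gam : R)
    (y : 'rV[R]_n) : Prop :=
  exists m : nat,
    gam = rho ^+ m * gt /\
    in_proj C (x - (rho ^+ m * gt) *: grad f x) y /\
    armijo_decrease f c (rho ^+ m * gt) x y /\
    (forall m' : nat, (m' < m)%N -> exists z,
       in_proj C (x - (rho ^+ m' * gt) *: grad f x) z /\
       ~ armijo_decrease f c (rho ^+ m' * gt) x z).

Section Backtracking.
Variables (R : realType) (n : nat) (C : set 'rV[R]_n) (f : 'rV[R]_n -> R).
Variables (c rho gt gam : R) (x y : 'rV[R]_n).
Hypothesis rho01 : 0 < rho < 1.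
Hypothesis gt0 : 0 < gt.
Hypothesis step : backtracking_step C f c rho gt x gam y.

Lemma backtracking_stepP : [/\ 0 < gam <= gt,
  in_proj C (x - gam *: grad f x) y & armijo_decrease f c gam x y].
Proof.
have [m [-> [? [? _]]]] := step; have /andP[rho0 rho1] := rho01.
by split=> //; rewrite mulr_gt0 ?exprn_gt0 //= ler_piMl ?exprn_ile1 // ltW.
Qed.

Lemma backtracking_step_ge K : 0 < K -> c < 2^-1 -> C x ->
  quad_majorant K f x (grad f x) -> Num.min gt (rho * (2^-1 - c) / K) <= gam.
Proof.
move=> K0 c12 Cx fK; have [m [-> [_ [_ rejected]]]] := step.
have /andP[rho0 _] := rho01.
case: m rejected => [_|m /(_ m (ltnSn m))[z [xz rejected]]].
  by rewrite expr0 mul1r ge_min lexx.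
rewrite ge_min exprS -!mulrA ler_pM2l // ler_pdivrMr //; apply/orP; right.
rewrite leNgt; apply/negP => short_step; apply: rejected.
apply: projected_step_armijo fK Cx _ (ltW short_step) xz.
by rewrite mulr_gt0 ?exprn_gt0.
Qed.

End Backtracking.

Lemma ler_sqr_perturb (R : realFieldType) (d D s e : R) :
  0 <= d -> 0 <= D -> 0 <= s -> 0 <= e <= 1 -> d <= D + s * e ->
  d ^+ 2 <= D ^+ 2 + e * (2 * s * D + s ^+ 2).
Proof.
move=> d0 D0 s0 /andP[e0 e1] dD.
have Dse0 : 0 <= D + s * e by rewrite addr_ge0 ?mulr_ge0.
apply: (@le_trans _ _ ((D + s * e) ^+ 2)); first by rewrite ler_pXn2r.
have : s ^+ 2 * e * e <= s ^+ 2 * e * 1 by rewrite ler_wpM2l ?mulr_ge0 ?sqr_ge0.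
by rewrite sqrrD; lra.
Qed.

Section ProjectedGradient.
Variables (R : realType) (n : nat) (C : set 'rV[R]_n).
Implicit Types (F : 'rV[R]_n -> R) (x y a G xs : 'rV[R]_n) (gam r Q B gt e : R).

Lemma enorm_step_le x a gam gt e : 0 < gam <= gt ->
  step_residual gam x a <= e -> enorm (a - x) <= gt * e.
Proof.
move=> /andP[gam0 gamgt] res.
rewrite enormBC -[x - a](scalerKV (lt0r_neq0 gam0)) enormZ_ge0 ?(ltW gam0) //.
by apply: ler_pM; rewrite ?enorm_ge0 // ltW.
Qed.

Lemma dotv_projected_gradient_ge x y a G gam gt r e B :
  0 < gam <= gt -> 0 < r -> reach_ge C r a -> C y ->
  in_proj C (x - gam *: G) a -> step_residual gam x a <= e -> enorm G <= B ->
  - (e * enorm (y - x) + (e + B) * ((2 * r)^-1 * enorm (y - a) ^+ 2 + gt * e))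
    <= dotv G (y - x).
Proof.
move=> gam_bounds r0 reach Cy xa res GB; have /andP[gam0 _] := gam_bounds.
pose u := gam^-1 *: (x - a); pose w := u - G.
have w_normal : proximal_normal C a w.
  exists gam => //; rewrite scalerBr scalerA mulfV ?gt_eqF // scale1r.
  by rewrite addrA subrKC.
have w_le : enorm w <= e + B.
  by apply: le_trans (enormD _ _) _; rewrite enormN lerD.
have -> : dotv G (y - x) = dotv u (y - x) - dotv w (y - a) - dotv w (a - x).
  by rewrite /w !dotvE; ring.
have u_yx : - (e * enorm (y - x)) <= dotv u (y - x).
  rewrite lerNl -dotvNl; apply: le_trans (dotv_le _ _) _.
  by rewrite enormN ler_wpM2r ?enorm_ge0.
have w_ax : dotv w (a - x) <= (e + B) * (gt * e).
  apply: le_trans (dotv_le _ _) _; apply: ler_pM; rewrite ?enorm_ge0 //.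
  exact: enorm_step_le gam_bounds res.
have w_ya : dotv w (y - a) <= (e + B) * ((2 * r)^-1 * enorm (y - a) ^+ 2).
  apply: le_trans (reach w y w_normal Cy) _; rewrite -mulrA ler_wpM2r //.
  by rewrite mulr_ge0 ?sqr_ge0 // invr_ge0 mulr_ge0 // ltW.
by move: u_yx w_ax w_ya; lra.
Qed.

Definition approx_stationary F xs Q B gt e : Prop :=
  exists f x a gam, [/\ quad_minorant Q f x (grad f x), enorm (grad f x) <= B,
    forall y, f y <= F y, F xs - e <= f x
    & [/\ 0 < gam <= gt, in_proj C (x - gam *: grad f x) a,
          step_residual gam x a <= e & enorm (x - xs) <= e]].

Lemma approx_stationary_ge F xs y Q B gt r : 0 <= Q -> 0 < r -> C y ->
  (forall a, eball xs r a -> reach_ge C r a) ->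
  exists c, forall e, 0 < e <= Num.min 1 (r / (1 + gt)) ->
    approx_stationary F xs Q B gt e ->
    F xs - (Q + (1 + B) / (2 * r)) * enorm (y - xs) ^+ 2 <= F y + e * c.
Proof.
move=> Q0 r0 Cy reach; set D := enorm (y - xs); pose m := (2 * r)^-1.
exists (2 + D + Q * (2 * 1 * D + 1 ^+ 2)
  + (1 + B) * (m * (2 * (1 + gt) * D + (1 + gt) ^+ 2) + gt)).
move=> e /andP[e0]; rewrite le_min => /andP[e1 er].
move=> [f [x [a [gam [minor GB fF fx [gam_bounds xa res xxs]]]]]].
have gt0 : 0 < gt by have /andP[/lt_le_trans] := gam_bounds; apply.
have D0 : 0 <= D by exact: enorm_ge0.
have m0 : 0 <= m by rewrite invr_ge0 mulr_ge0 // ltW.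
have gt1 : 0 < 1 + gt by rewrite addr_gt0.
have e01 : 0 <= e <= 1 by rewrite (ltW e0).
have axs : enorm (a - xs) <= (1 + gt) * e.
  by have := enormB_triangle x a xs; have := enorm_step_le gam_bounds res; lra.
have axs_r : eball xs r a.
  by apply: le_trans axs _; rewrite mulrC -ler_pdivlMr.
have yx : enorm (y - x) <= D + 1 * e.
  by have := enormB_triangle xs y x; rewrite (enormBC xs) -/D; move: xxs; lra.
have ya : enorm (y - a) <= D + (1 + gt) * e.
  by have := enormB_triangle xs y a; rewrite (enormBC xs) -/D; move: axs; lra.
have yx2 := ler_sqr_perturb (enorm_ge0 _) D0 ler01 e01 yx.
have ya2 := ler_sqr_perturb (enorm_ge0 _) D0 (ltW gt1) e01 ya.
have first_order : e * enorm (y - x) <= e * (D + 1).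
  by rewrite ler_pM2l // (le_trans yx) // mul1r lerD2l.
have normal_part : (e + B) * (m * enorm (y - a) ^+ 2 + gt * e) <=
    (1 + B) * (m * (D ^+ 2 + e * (2 * (1 + gt) * D + (1 + gt) ^+ 2)) + gt * e).
  apply: ler_pM; rewrite ?lerD2r ?ler_wpM2l //.
    by rewrite addr_ge0 ?(ltW e0) // (le_trans (enorm_ge0 _) GB).
  by rewrite addr_ge0 ?mulr_ge0 ?enorm_ge0 ?(ltW e0) ?(ltW gt0).
have := dotv_projected_gradient_ge gam_bounds r0 (reach a axs_r) Cy xa res GB.
have := ler_wpM2l Q0 yx2; have := minor y; have := fF y.
by move: first_order normal_part fx; rewrite -/m; lra.
Qed.

Lemma approx_stationary_limit (F : 'rV[R]_n -> R) xs (Q B gt : R) :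
  closed C -> prox_regular C -> C xs -> 0 < gt -> 0 <= Q ->
  (forall e, 0 < e -> approx_stationary F xs Q B gt e) ->
  exists K, forall y, C y -> F xs - K * enorm (y - xs) ^+ 2 <= F y.
Proof.
move=> cC prC Cxs gt0 Q0 approx.
have [r r0 reach] := prox_regular_reach_ge cC prC Cxs.
exists (Q + (1 + B) / (2 * r)) => y Cy.
have [c F_ge] := approx_stationary_ge F B gt Q0 r0 Cy reach.
have t0 : 0 < Num.min 1 (r / (1 + gt)).
  by rewrite lt_min ltr01 divr_gt0 ?addr_gt0.
apply: (ler_addM_small t0) => e e_small; have /andP[e0 _] := e_small.
exact: F_ge (approx e e0).
Qed.

Lemma frechet_subdiff_constrained0 (F : 'rV[R]_n -> R) xs K : C xs ->
  (forall y, C y -> F xs - K * enorm (y - xs) ^+ 2 <= F y) ->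
  frechet_subdiff (fun y => (F y)%:E + iotaC C y)%E xs 0.
Proof.
move=> Cxs FK; have iotaC0 y : C y -> iotaC C y = 0%E.
  by move=> Cy; rewrite /iotaC asboolT.
apply: (@quad_minorant_frechet_subdiff _ _ _ (F xs) K) => [|y].
  by rewrite iotaC0 // adde0.
rewrite dotv0l addr0; have [Cy|nCy] := pselect (C y).
  by rewrite iotaC0 // adde0 lee_fin FK.
by rewrite /iotaC asboolF // addey // leey.
Qed.

End ProjectedGradient.

Lemma harmonic_tail_unbounded (R : realType) (N : nat) (B : R) :
  exists2 i, (N <= i)%N & B < \sum_(N <= j < i) j.+1%:R^-1.
Proof.
apply: contrapT => bounded; apply: (@dvg_harmonic R).
have harmonic_mono : nondecreasing_seq (series (@harmonic R)).
  by apply/nondecreasing_seqP => i; rewrite seriesSr lerDl invr_ge0.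
apply: nondecreasing_is_cvgn => //.
exists (series (@harmonic R) N + B) => _ [i _ <-].
apply: le_trans (harmonic_mono _ _ (leq_addl N i)) _.
rewrite -lerBlDl sub_series_geq ?leq_addr // leNgt.
by apply/negP => lt_B; apply: bounded; exists (N + i)%N; rewrite ?leq_addr.
Qed.

Lemma harmonic_descent_small (R : realType) (Phi res : nat -> R) b kappa :
  0 < kappa -> (forall j, (1 <= j)%N -> b <= Phi j) ->
  (forall j, (1 <= j)%N -> Phi j.+1 <= Phi j - kappa / j.+1%:R * res j ^+ 2) ->
  forall e N, 0 < e -> exists2 j, (N <= j)%N & (1 <= j)%N && (res j <= e).
Proof.
move=> kappa0 Phi_ge descent e N e0; apply: contrapT => none.
have ke0 : 0 < kappa * e ^+ 2 by rewrite mulr_gt0 ?exprn_gt0.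
have drop j : (maxn N 1 <= j)%N ->
    kappa * e ^+ 2 * j.+1%:R^-1 <= Phi j - Phi j.+1.
  rewrite geq_max => /andP[Nj j1].
  have res_gt : e < res j.
    by rewrite ltNge; apply/negP => res_le; apply: none; exists j; rewrite ?j1.
  rewrite [leLHS]mulrAC lerBrDl -lerBrDr (le_trans (descent j j1)) //.
  rewrite lerD2l lerN2.
  rewrite ler_wpM2l ?divr_ge0 ?(ltW kappa0) // ltW // ltr_pXn2r ?nnegrE //.
    exact: ltW.
  by rewrite ltW // (lt_trans e0).
have [i Ni] := harmonic_tail_unbounded (maxn N 1)
  ((Phi (maxn N 1) - b) / (kappa * e ^+ 2)).
rewrite ltr_pdivrMr // mulrC mulr_sumr ltNge => /negP; apply.
apply: (@le_trans _ _ (\sum_(maxn N 1 <= j < i) (Phi j - Phi j.+1))).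
  by apply: ler_sum_nat => j /andP[/drop].
rewrite (telescope_sumr_eq (fun j => - Phi j)) // => [|j _]; last first.
  by rewrite opprK addrC.
rewrite opprK addrC lerD2l lerN2 Phi_ge //.
by rewrite (leq_trans _ Ni) // leq_maxr.
Qed.

Lemma limn_einf_eq0 (R : realType) (u : nat -> \bar R) :
  (forall j, (0 <= u j)%E) ->
  (forall (e : R) N, 0 < e -> exists2 j, (N <= j)%N & (u j <= e%:E)%E) ->
  limn_einf u = 0%E.
Proof.
move=> u0 us; rewrite limn_einf_lim.
suff -> : einfs u = cst 0%E by exact: lim_cst.
apply/funext => N; apply/le_anti/andP; split; last first.
  by apply: le_ereal_inf_tmp => _ [j _ <-].
apply/lee_addgt0Pr => e e0; rewrite add0e.
have [j Nj uj] := us e N e0.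
by apply: le_trans uj; apply: ereal_inf_lbound; exists j.
Qed.

Section SmoothingParameter.
Variables (R : realType) (eta a : R).
Hypothesis eta0 : 0 < eta.
Hypothesis a01 : 0 < a <= 1.

Definition smoothing_parameter (j : nat) : R := (2 * eta)^-1 * (j%:R `^ (- a)).

Local Notation mu := smoothing_parameter.

Let eta2_gt0 : 0 < (2 * eta)^-1.
Proof. by rewrite invr_gt0 mulr_gt0. Qed.

Let powR_nat_gt0 (j : nat) : (1 <= j)%N -> 0 < j%:R `^ a :> R.
Proof. by move=> j1; rewrite powR_gt0 // ltr0n. Qed.

Lemma smoothing_parameter_gt0 j : (1 <= j)%N -> 0 < mu j.
Proof. by move=> j1; rewrite mulr_gt0 // powR_gt0 // ltr0n. Qed.

Lemma smoothing_parameter_le1 j : (1 <= j)%N -> 2 * eta * mu j <= 1.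
Proof.
move=> j1; have /andP[a0 _] := a01; rewrite mulVKf ?gt_eqF ?mulr_gt0 //.
rewrite powRN invf_le1 ?powR_nat_gt0 // -[leLHS](powRr0 j%:R).
by rewrite ler_powR ?ler1n // ltW.
Qed.

Lemma smoothing_parameter_ge j : (1 <= j)%N -> (2 * eta)^-1 / j.+1%:R <= mu j.
Proof.
move=> j1; have /andP[_ a1] := a01; rewrite ler_pM2l //.
apply: (@le_trans _ _ j%:R^-1); first by rewrite lef_pV2 ?posrE ?ltr0n ?ler_nat.
by rewrite powRN lef_pV2 ?posrE ?powR_nat_gt0 ?ltr0n // ler1_powR // ler1n.
Qed.

Lemma smoothing_parameter_decr j : (1 <= j)%N -> mu j.+1 <= mu j.
Proof.
move=> j1; have /andP[a0 _] := a01.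
rewrite ler_pM2l // !powRN lef_pV2 ?posrE ?powR_nat_gt0 //.
by apply: ge0_ler_powR; rewrite ?nnegrE ?ler0n ?ler_nat ?ltW.
Qed.

Lemma smoothing_parameter_small e : 0 < e ->
  exists N : nat, forall j, (N <= j)%N -> mu j <= e.
Proof.
move=> e0; have /andP[a0 _] := a01; pose d := 2 * eta * e.
have d0 : 0 < d by rewrite !mulr_gt0.
pose b := d^-1 `^ a^-1; have b0 : 0 < b by rewrite powR_gt0 // invr_gt0.
exists (Num.bound b) => j bj.
have b_le_j : b <= j%:R.
  by apply: le_trans (ltW (archi_boundP (ltW b0))) _; rewrite ler_nat.
have j0 : 0 < j%:R :> R by exact: lt_le_trans b_le_j.
rewrite ler_pdivrMl ?mulr_gt0 // -/d powRN -[d]invrK.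
rewrite lef_pV2 ?posrE ?powR_gt0 ?invr_gt0 //.
have : b `^ a <= j%:R `^ a.
  by apply: ge0_ler_powR; rewrite ?nnegrE ?(ltW a0) ?(ltW b0) ?(ltW j0).
by rewrite -powRrM mulVf ?gt_eqF // powRr1 // invr_ge0 ltW.
Qed.

End SmoothingParameter.

Section ProjectedVariableSmoothing.
Variables (R : realType) (n k : nat) (S : 'rV[R]_n -> 'rV[R]_k).
Variables (g : 'rV[R]_k -> R) (C : set 'rV[R]_n) (L LS LD eta : R).
Hypothesis dS : forall y, differentiable S y.
Hypothesis LS0 : 0 < LS.
Hypothesis SL : forall x y, enorm (S x - S y) <= LS * enorm (x - y).
Hypothesis LD0 : 0 < LD.
Hypothesis DSL : forall x y v,
  enorm ('d S x v - 'd S y v) <= LD * enorm (x - y) * enorm v.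
Hypothesis L0 : 0 < L.
Hypothesis gL : forall x y, `|g x - g y| <= L * enorm (x - y).
Hypothesis eta0 : 0 < eta.
Hypothesis gconv : weakly_convex eta g.

Variables (mu gam : nat -> R) (x : nat -> 'rV[R]_n) (c rho gt : R).
Hypothesis mu0 : forall j, (1 <= j)%N -> 0 < mu j.
Hypothesis etamu : forall j, (1 <= j)%N -> 2 * eta * mu j <= 1.
Hypothesis c0 : 0 < c.
Hypothesis c12 : c < 2^-1.
Hypothesis rho01 : 0 < rho < 1.
Hypothesis gt0 : 0 < gt.
Hypothesis Cx1 : C (x 1%N).

Let F (j : nat) := fun y => moreau (mu j) g (S y).

Hypothesis step : forall j, (1 <= j)%N ->
  backtracking_step C (F j) c rho gt (x j) (gam j) (x j.+1).

Let M j := Mstat (gam j) (fun y => (F j y)%:E) C (x j).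

Lemma iterate_feasible j : (1 <= j)%N -> C (x j).
Proof.
by case: j => [//|[//|j]] _; have [_ [_ [[? _] _]]] := @step j.+1 isT.
Qed.

Let F_bounds j (j1 : (1 <= j)%N) := smoothed_quad_bounds dS LS0 SL LD0 DSL L0 gL
  eta0 gconv (mu0 j1) (etamu j1) (x j).

Let step_spec j (j1 : (1 <= j)%N) := backtracking_stepP rho01 gt0 (step j1).

Lemma Mstat_iterateE j : (1 <= j)%N -> M j = ereal_inf
  [set (step_residual (gam j) (x j) p)%:E
  | p in in_proj C (x j - gam j *: grad (F j) (x j))].
Proof. by move=> /F_bounds[minor major _]; exact: MstatE minor major. Qed.

Lemma Mstat_le_residual j : (1 <= j)%N ->
  (M j <= (step_residual (gam j) (x j) (x j.+1))%:E)%E.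
Proof.
move=> j1; rewrite Mstat_iterateE //; apply: ereal_inf_lbound.
by exists (x j.+1) => //; have [] := step_spec j1.
Qed.

Lemma step_size_ge :
  exists2 s, 0 < s & forall j, (1 <= j)%N -> s * mu j <= gam j.
Proof.
pose Q := upper_curvature L LS LD eta.
have Q0 : 0 < Q by exact: upper_curvature_gt0.
have /andP[rho0 _] := rho01.
exists (Num.min (gt * (2 * eta)) (rho * (2^-1 - c) / Q)) => [|j j1].
  by rewrite lt_min !mulr_gt0 ?invr_gt0 // subr_gt0.
have [_ major _] := F_bounds j1.
apply: le_trans (backtracking_step_ge rho01 gt0 (step j1) (divr_gt0 Q0 (mu0 j1))
  c12 (iterate_feasible j1) major).
have first_step : gt * (2 * eta) * mu j <= gt.
  by rewrite -mulrA ler_piMr ?etamu // ltW.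
rewrite -/Q invf_div [mu j / Q]mulrC [_ * (Q^-1 * _)]mulrA.
by rewrite minr_pMl ?(ltW (mu0 j1)) // le_min !ge_min first_step lexx orbT.
Qed.

Definition energy (j : nat) : R := F j (x j) + L ^+ 2 / 2 * mu j.

Lemma energy_descent j : (1 <= j)%N -> mu j.+1 <= mu j ->
  energy j.+1 <=
    energy j - c * gam j * step_residual (gam j) (x j) (x j.+1) ^+ 2.
Proof.
move=> j1 mu_le; have [_ _ decr] := step_spec j1.
apply: (@le_trans _ _ (F j (x j.+1) + L ^+ 2 / 2 * mu j)).
  rewrite /energy -lerBrDr -addrA -mulrBr.
  exact: (moreau_decr L0 gL (S (x j.+1)) (@mu0 j.+1 isT) mu_le).
by rewrite /energy addrAC lerD2r.
Qed.

Lemma energy_ge j : (1 <= j)%N -> g (S (x j)) <= energy j.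
Proof. by move=> /mu0 muj; rewrite /energy -lerBlDr (moreau_ge gL). Qed.

Lemma limn_einf_Mstat b : 0 < b ->
  (forall j, (1 <= j)%N -> b / j.+1%:R <= mu j) ->
  (forall j, (1 <= j)%N -> mu j.+1 <= mu j) ->
  (exists m, forall y, C y -> m <= g (S y)) -> limn_einf M = 0%E.
Proof.
move=> b0 mu_ge mu_decr [m m_le].
have [s s0 gam_ge] := step_size_ge.
apply: limn_einf_eq0 => [j|e N e0].
  by apply: le_ereal_inf_tmp => _ [p _ <-]; rewrite lee_fin enorm_ge0.
pose res j := step_residual (gam j) (x j) (x j.+1).
have csb0 : 0 < c * (s * b) by rewrite !mulr_gt0.
have [|j j1|j Nj /andP[j1 res_le]] :=
  harmonic_descent_small (Phi := energy) (res := res) (b := m) csb0 _ _ N e0.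
- by move=> j j1; apply: le_trans (energy_ge j1); exact/m_le/iterate_feasible.
- apply: le_trans (energy_descent j1 (mu_decr j j1)) _.
  rewrite lerD2l lerN2 ler_wpM2r ?sqr_ge0 // -!mulrA ler_pM2l //.
  by apply: le_trans (gam_ge j j1); rewrite ler_pM2l // mu_ge.
- by exists j => //; apply: le_trans (Mstat_le_residual j1) _; rewrite lee_fin.
Qed.

Lemma Mstat_lt_approx_stationary : exists2 q, 0 < q &
  forall j xs e, (1 <= j)%N -> 0 < e ->
    (M j < e%:E)%E -> mu j <= e -> enorm (x j - xs) <= e ->
    approx_stationary C (g \o S) xs (lower_curvature L LS LD eta) (2 * L * LS)
      gt (q * e).
Proof.
have LLS0 : 0 <= L * LS by rewrite mulr_ge0 // ltW.
have L20 : 0 <= L ^+ 2 / 2 by rewrite divr_ge0 ?sqr_ge0.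
exists (1 + (L * LS + L ^+ 2 / 2)) => [|j xs e j1 e0 Mj mue xxs].
  by rewrite ltr_wpDr // addr_ge0.
have [minor _ grad_le] := F_bounds j1; have [gam_bounds _ _] := step_spec j1.
move: Mj; rewrite Mstat_iterateE // => /ereal_inf_lt[_ [a xa <-]].
rewrite lte_fin => res.
have e_le : e <= (1 + (L * LS + L ^+ 2 / 2)) * e.
  by rewrite ler_peMl ?(ltW e0) // lerDl addr_ge0.
exists (F j), (x j), a, (gam j); split=> // [y||].
- by apply: (moreau_le_fun L0 gL); exact: mu0.
- have := moreau_ge gL (S (x j)) (mu0 j1).
  have := lipschitz_ge gL (S (x j)) (S xs).
  have : L * enorm (S (x j) - S xs) <= L * (LS * e).
    by rewrite ler_pM2l // (le_trans (SL _ _)) // ler_pM2l.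
  by have := ler_wpM2l L20 mue; rewrite /F /=; lra.
- by split=> //; [exact: le_trans (ltW res) e_le|exact: le_trans xxs e_le].
Qed.

Lemma cluster_Mstat_stationary (sub : nat -> nat) xs :
  closed C -> prox_regular C ->
  (forall i j, (i < j)%N -> (sub i < sub j)%N) -> (forall l, (1 <= sub l)%N) ->
  (forall e, 0 < e -> exists N, forall j, (N <= j)%N -> mu j <= e) ->
  (fun l => M (sub l)) @ \oo --> 0%E -> C xs ->
  cluster ((fun l => x (sub l)) @ \oo) xs ->
  frechet_subdiff (fun y => (g (S y))%:E + iotaC C y)%E xs 0.
Proof.
move=> cC prC sub_incr sub1 mu_small Mcvg Cxs xs_cluster.
have le_sub l : (l <= sub l)%N.
  by elim: l => [//|l IH]; exact: leq_ltn_trans IH (sub_incr _ _ (ltnSn l)).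
have [q q0 stationary] := Mstat_lt_approx_stationary.
have Q0 : 0 <= lower_curvature L LS LD eta.
  by rewrite addr_ge0 ?mulr_ge0 ?sqr_ge0 // ltW.
have [|K FK] := approx_stationary_limit (F := g \o S) (B := 2 * L * LS)
  cC prC Cxs gt0 Q0.
  move=> e e0; have eq0 : 0 < e / q by rewrite divr_gt0.
  have [N1 muN1] := mu_small _ eq0.
  have [N2 _ MN2] : \forall l \near \oo, (M (sub l) < (e / q)%:E)%E.
    apply: (Mcvg [set z | (z < (e / q)%:E)%E]).
    by apply: open_ereal_lt'; rewrite lte_fin.
  have [l] := cluster_enorm xs_cluster (maxn N1 N2) eq0.
  rewrite geq_max => /andP[N1l N2l] xl.
  have -> : e = q * (e / q) by rewrite mulrC divfK ?gt_eqF.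
  apply: stationary (sub1 l) eq0 (MN2 l N2l) _ (ltW xl).
  exact: muN1 (leq_trans N1l (le_sub l)).
exact: frechet_subdiff_constrained0 Cxs FK.
Qed.

End ProjectedVariableSmoothing.

Theorem theorem2 (R : realType) (n k : nat)
  (S : 'rV[R]_n -> 'rV[R]_k) (g : 'rV[R]_k -> R) (eta : R)
  (C : set 'rV[R]_n)
  (x : nat -> 'rV[R]_n) (gam : nat -> R)
  (c rho gt alpha : R) :
  (forall y, differentiable S y) -> elipschitz S -> deriv_lipschitz S ->
  elipschitz_real g -> 0 < eta -> weakly_convex eta g ->
  C !=set0 -> closed C -> prox_regular C ->
  (exists xs, C xs /\ forall y, C y -> g (S xs) <= g (S y)) ->
  C (x 1%N) -> 0 < c < 2^-1 -> 0 < rho < 1 -> 0 < gt -> 1 <= alpha ->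
  let mu := fun j : nat => (2 * eta)^-1 * (j%:R `^ (- alpha^-1)) in
  let Fn := fun j : nat => fun y => moreau (mu j) g (S y) in
  let test := fun (j m : nat) (y : 'rV[R]_n) =>
    Fn j y <= Fn j (x j) - c * (rho ^+ m * gt)
                 * enorm ((rho ^+ m * gt)^-1 *: (x j - y)) ^+ 2 in
  (forall j : nat, (1 <= j)%N -> exists m : nat,
      gam j = rho ^+ m * gt /\
      in_proj C (x j - (rho ^+ m * gt) *: grad (Fn j) (x j)) (x j.+1) /\
      test j m (x j.+1) /\
      (forall m' : nat, (m' < m)%N -> exists y,
         in_proj C (x j - (rho ^+ m' * gt) *: grad (Fn j) (x j)) y /\
         ~ test j m' y)) ->
  let M := fun j : nat => Mstat (gam j) (fun y => (Fn j y)%:E) C (x j) in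
  limn_einf M = 0%E /\
  (forall sub : nat -> nat,
     (forall i j, (i < j)%N -> (sub i < sub j)%N) ->
     (forall l, (1 <= sub l)%N) ->
     (fun l => M (sub l)) @ \oo --> 0%E ->
     forall xs, C xs -> cluster ((fun l => x (sub l)) @ \oo) xs ->
       frechet_subdiff (fun y => (g (S y))%:E + iotaC C y)%E xs 0).
Proof.
move=> dS /elipschitz_pos[LS LS0 SL] /deriv_lipschitz_pos[LD LD0 DSL].
move=> /elipschitz_real_pos[L L0 gL] eta0 gconv _ cC prC [xmin [_ F_ge]] Cx1.
move=> /andP[c0 c12] rho01 gt0 alpha1 mu Fn test alg M.
have a01 : 0 < alpha^-1 <= 1.
  have alpha0 : 0 < alpha by exact: lt_le_trans alpha1.
  by rewrite invr_gt0 alpha0 /= invf_le1.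
have mu0 j : (1 <= j)%N -> 0 < mu j by exact: smoothing_parameter_gt0.
have etamu j : (1 <= j)%N -> 2 * eta * mu j <= 1.
  exact: smoothing_parameter_le1.
split=> [|sub sub_incr sub1 Mcvg xs Cxs xs_cluster].
  apply: (limn_einf_Mstat dS LS0 SL LD0 DSL L0 gL eta0 gconv mu0 etamu c0 c12
    rho01 gt0 Cx1 alg (b := (2 * eta)^-1)).
  - by rewrite invr_gt0 mulr_gt0.
  - exact: smoothing_parameter_ge.
  - exact: smoothing_parameter_decr.
  - by exists (g (S xmin)).
apply: (cluster_Mstat_stationary dS LS0 SL LD0 DSL L0 gL eta0 gconv mu0 etamu
  rho01 gt0 alg cC prC sub_incr sub1 _ Mcvg Cxs xs_cluster).
exact: smoothing_parameter_small.
Qed.
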